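(* Let $\alpha,\beta$ be nonzero real numbers, and consider the four points $(t_1,\xi_1)=(0,0)$, $(t_2,\xi_2)=(1,0)$, $(t_3,\xi_3)=(0,\alpha)$, $(t_4,\xi_4)=(1,\beta)$. Assume that at least one of the following holds: (a) $$\liminf_{n\to\infty}\, n\log n\,\min\Big\{\Big\|n\frac{\beta}{\alpha}\Big\|,\Big\|n\frac{\alpha}{\beta}\Big\|\Big\}<\infty;$$ (b) at least one of $\alpha,\beta$ is rational. Then there is no $f\in L^2(\mathbb{R})$, $f:\mathbb{R}\to\mathbb{C}$, not a.e. equal to zero, for which there exist complex numbers $d_1,\dots,d_4$, not all zero, with $$\sum_{j=1}^4 d_j f(x+t_j)e^{2\pi i \xi_j x}=0\quad\text{for a.e. }x\in\mathbb{R}.$$ Moreover, in either case, there is no measurable function $f:\mathbb{R}\to\mathbb{C}$, not a.e. equal to zero, which satisfies such a relation with coefficients $d_1,\dots,d_4$ not all zero and which has the minimal decay $$\lim_{|n|\to\infty,\ n\in\mathbb{Z}}|f(x+n)|=0\quad\text{for a.e. }x.$$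
   Context: $\|x\|$ denotes the distance from the real number $x$ to the nearest integer. *)

(* Defs.v *)
From HB Require Import structures.
From mathcomp Require Import all_boot all_order all_algebra.
From mathcomp Require Import all_classical all_reals all_analysis.
From mathcomp Require Import complex.

Set Implicit Arguments.
Unset Strict Implicit.
Unset Printing Implicit Defensive.
Import Order.TTheory GRing.Theory Num.Theory.
Import numFieldNormedType.Exports.
Import ComplexField.Normc.

Local Open Scope classical_set_scope.
Local Open Scope ring_scope.

(* The real line with the sigma-algebra of Lebesgue (Caratheodory) measurable
   sets; the library's default structure on [R] is the Borel one. *)
Notation lebesgueType R := (caratheodory_type (wlength (@idfun R))^*%mu).

Section Definitions.
Context {R : realType}.

Local Notation mu := (@completed_lebesgue_measure R).

Definition dist_int (x : R) : R := inf [set `|x - m%:~R| | m in [set: int]].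

(* e^{2 pi i x} *)
Definition cis2pi (x : R) : R[i] :=
  Complex (cos (2 * pi * x)) (sin (2 * pi * x)).

Definition cmeasurable (f : R -> R[i]) : Prop :=
  measurable_fun [set: lebesgueType R] (fun x => complex.Re (f x)) /\
  measurable_fun [set: lebesgueType R] (fun x => complex.Im (f x)).

Definition ae_zero (f : R -> R[i]) : Prop := {ae mu, forall x, f x = 0}.

Definition square_integrable (f : R -> R[i]) : Prop :=
  cmeasurable f /\ (\int[mu]_x ((normc (f x)) ^+ 2)%:E < +oo)%E.

(* A point is a pair [(t, xi)], acting on [f] by
   [x |-> f (x + t) * e^{2 pi i xi x}]. *)
Definition tf_dependent (n : nat) (p : n.-tuple (R * R)) (f : R -> R[i]) :
    Prop :=
  exists d : 'I_n -> R[i], (exists j, d j != 0) /\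
    {ae mu, forall x : R, \sum_(j < n)
      d j * f (x + (tnth p j).1) * cis2pi ((tnth p j).2 * x) = 0}.

(* The cofinite filter on [int] expresses |n| -> oo. *)
Definition minimal_decay (f : R -> R[i]) : Prop :=
  {ae mu, forall x : R,
    normc (f (x + n%:~R)) @[n --> (@frechet_filter int : set_system int)]
      --> (0 : R)}.

End Definitions.

(* Main.v *)
Require Import Defs.
From mathcomp Require Import all_boot all_order all_algebra.
From mathcomp Require Import all_classical all_reals all_analysis.
From mathcomp Require Import measurable_realfun complex ring lra zify.
Import Order.TTheory GRing.Theory Num.Theory.
Import numFieldNormedType.Exports.
Import ComplexField.Normc.
Local Open Scope classical_set_scope.
Local Open Scope ring_scope.

(** Put u = |f|, p(x) = |d_1 + d_3 e(alpha x)| and q(x) = |d_2 + d_4 e(beta x)|,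
    where e(x) = exp(2 pi i x).  The dependence says q(x) u(x + 1) = p(x) u(x)
    for a.e. x, so along an orbit x + Z the function u is a product of quotients
    p / q.  The idea is that the near periods of p and q, or their symmetries,
    make the product that leads from x into the future essentially equal to the
    product that leads into x from the past; then u cannot decay in both
    directions.  An L^2 function decays along almost every orbit
    (square_integrable_decay), so only decaying functions have to be excluded.
    Only |f| matters, and it agrees a.e. with a Borel function (borel_version).

    Diophantine case (no_decaying_orbit_diophantine).  Suppose n beta / alpha is
    within O(1 / (n log n)) of an integer.  Then T = n / |alpha| is a period of p
    and a period of q up to an error delta = O(1 / (n log n)).  On a set A in
    [0, 1[ of positive measure, u is bounded below, and it is tiny on the far part
    of the orbits (persistent_set).  By pigeonhole (return_pair) some x and
    z = x + l T - N in A differ by a bounded multiple l of T modulo 1, with N an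
    integer of size O(n).  Comparing the product from z to z + N = x + l T with the
    one from x - N to x gives
      u(z + N) u(x - N) prod_k q(z + k) = u(z) u(x) prod_k q(x - N + k),
    where z + k and x - N + k differ by l delta modulo the period of q.  The
    quotient of the two products of q is at most
    exp(O(|delta|) sum_k 1 / q(x - N + k)), and off a set of small measure the
    sum over N points is O(N log N) (reciprocal_sum).  So this quotient is
    bounded, while u(z + N) u(x - N) / (u(z) u(x)) is as small as desired.

    Rational case (no_decaying_orbit_rational).  If alpha = a / d, then p has
    period d, so for d | M
      u(x + M) u(x - M) prod_(0 <= k < M) q(x + k)
        = u(x)^2 prod_(1 <= k <= M) q(x - k).
    If beta is rational too, the two products coincide for suitable M, and
    u(x + M) u(x - M) = u(x)^2 cannot tend to 0.  Otherwise q is even about some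
    point, hence a reflection x |-> z exchanges the two products, and the two
    identities multiplied together give
      u(x + M) u(x - M) u(z + M) u(z - M) = u(x)^2 u(z)^2.
    The admissible sums x + z form a translate of Z + Z / beta, which is dense, so
    both x and z can be taken in the support of u (sum_meets_dense).

    Reflecting the line exchanges the roles of (alpha, p) and (beta, q), which
    settles the other half of each hypothesis (no_decaying_orbit). *)

(** * Translations, reflections and overlaps on the real line *)

Section invariance.
Context {R : realType}.
Local Notation mu := (@lebesgue_measure R).

Lemma measurable_shift (t : R) : measurable_fun [set: R] (fun x : R => x + t).
Proof. by apply: measurable_funD => //; exact: measurable_cst. Qed.

Lemma measurable_flip (t : R) : measurable_fun [set: R] (fun x : R => t - x).
Proof. by apply: measurable_funB => //; exact: measurable_cst. Qed.

(** Lebesgue measure is the only measure with the right values on the intervals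
    that generate the Borel sets, so it suffices to test those. *)
Lemma lebesgue_measure_isometry
  (f : measurableTypeR R -> measurableTypeR R) (mf : measurable_fun setT f) :
  (forall a b : R, a < b -> mu (f @^-1` `]a, b]%classic) = (b - a)%:E) ->
  forall A : set (measurableTypeR R), measurable A -> mu (f @^-1` A) = mu A.
Proof.
move=> fE A mA.
rewrite [RHS](@lebesgue_measure_unique R (pushforward mu f))//.
move=> X /ocitvP[->|[[a b] /= ab ->]].
  by rewrite !measure0.
by rewrite /pushforward fE// lebesgue_measure_itv/= lte_fin ab EFinB.
Qed.

Lemma lebesgue_measure_shift (t : R) (A : set R) : measurable A ->
  mu ((fun x => x + t) @^-1` A) = mu A.
Proof.
move=> mA; apply: (@lebesgue_measure_isometry _ (measurable_shift t) _ A mA) => a b ab.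
rewrite [X in mu X](_ : _ = `]a - t, b - t]%classic); last first.
  by apply/seteqP; split => x /=; rewrite !in_itv/= ltrBlDr lerBrDr.
by rewrite lebesgue_measure_itv/= lte_fin ltrD2r ab -EFinD; congr (_%:E); ring.
Qed.

Lemma lebesgue_measure_flip (t : R) (A : set R) : measurable A ->
  mu ((fun x => t - x) @^-1` A) = mu A.
Proof.
move=> mA; apply: (@lebesgue_measure_isometry _ (measurable_flip t) _ A mA) => a b ab.
rewrite [X in mu X](_ : _ = `[t - b, t - a[%classic); last first.
  apply/seteqP; split => x /=; rewrite !in_itv/= => /andP[? ?]; apply/andP; split; lra.
by rewrite lebesgue_measure_itv/= lte_fin ltrD2l ltrN2 ab -EFinD; congr (_%:E); ring.
Qed.

Lemma ae_preimage (f : R -> R) (mf : measurable_fun setT f) (P : R -> Prop) :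
  (forall A : set R, measurable A -> mu (f @^-1` A) = mu A) ->
  {ae mu, forall x, P x} -> {ae mu, forall x, P (f x)}.
Proof.
move=> fE [N [mN N0 PN]]; exists (f @^-1` N); split.
- by rewrite -[X in measurable X]setTI; exact: mf.
- by rewrite fE.
- by move=> x /= nPx; apply: PN.
Qed.

Lemma ae_shift (t : R) (P : R -> Prop) :
  {ae mu, forall x, P x} -> {ae mu, forall x, P (x + t)}.
Proof.
exact: (@ae_preimage _ (measurable_shift t) P (@lebesgue_measure_shift t)).
Qed.

Lemma ae_flip (t : R) (P : R -> Prop) :
  {ae mu, forall x, P x} -> {ae mu, forall x, P (t - x)}.
Proof.
exact: (@ae_preimage _ (measurable_flip t) P (@lebesgue_measure_flip t)).
Qed.

Lemma ae_impl (P Q : R -> Prop) : (forall x, P x -> Q x) ->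
  {ae mu, forall x, P x} -> {ae mu, forall x, Q x}.
Proof.
move=> PQ; apply: negligibleS => x /= nQx Px; apply: nQx; exact: PQ.
Qed.

Lemma ae_and (P Q : R -> Prop) : {ae mu, forall x, P x} ->
  {ae mu, forall x, Q x} -> {ae mu, forall x, P x /\ Q x}.
Proof.
move=> aP aQ; apply: negligibleS (negligibleU aP aQ) => x /= nPQ.
by apply/not_andP.
Qed.

Lemma ae_shift_int (P : R -> Prop) :
  {ae mu, forall x, P x} -> {ae mu, forall x, forall n : int, P (x + n%:~R)}.
Proof.
move=> aeP.
have : {ae mu, forall x, forall k : nat, if (unpickle k : option int) is Some n
     then P (x + n%:~R) else True}.
  by apply: ae_foralln => k; case: unpickle => [n|]; [exact: ae_shift|exact: aeW].
apply: ae_impl => x Px n; have := Px (pickle n).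
by rewrite pickleK.
Qed.

End invariance.

Section overlap.
Context {R : realType}.
Local Notation mu := (@lebesgue_measure R).

(** The Bonferroni inequality: among m sets of measure at least a inside a
    set of measure u < m a, some two must overlap. *)
Lemma pairwise_overlap (B : nat -> set R) (U : set R) (a u c : R) (m : nat) :
  measurable U -> mu U = u%:E ->
  (forall i, (i < m)%N -> [/\ measurable (B i), B i `<=` U & (a%:E <= mu (B i))%E]) ->
  0 <= c -> u + (m ^ 2)%:R * c < m%:R * a ->
  exists i j, [/\ (i < j)%N, (j < m)%N & (c%:E <= mu (B i `&` B j))%E].
Proof.
move=> mU muU HB c0 lt.
apply: contrapT => /forallNP H.
have {}H i j : (i < j)%N -> (j < m)%N -> (mu (B i `&` B j) < c%:E)%E.
  move=> ij jm; rewrite ltNge; apply/negP => cle.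
  by have /forallNP/(_ j) := H i; apply; split.
have mB k : (k <= m)%N -> measurable (\big[setU/set0]_(i < k) B i).
  move=> km; apply: bigsetU_measurable => i _.
  by have [] := HB i (leq_trans (ltn_ord i) km).
have BU k : (k <= m)%N -> \big[setU/set0]_(i < k) B i `<=` U.
  move=> km; rewrite -bigcup_mkord => x [i /= ik Bx].
  by have [_ + _] := HB i (leq_trans ik km); apply.
have key k : (k <= m)%N ->
  ((k%:R * a)%:E <= mu (\big[setU/set0]_(i < k) B i) + ((k ^ 2)%:R * c)%:E)%E.
  elim: k => [|k IH] km.
    by rewrite big_ord0 measure0 expnS mul0n !mul0r adde0.
  have {}IH := IH (ltnW km).
  rewrite big_ord_recr/=.
  set V := \big[setU/set0]_(i < k) B i in IH *.
  have mV : measurable V by apply: mB; exact: ltnW.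
  have [mBk BkU aBk] := HB k km.
  have fin X : measurable X -> X `<=` U -> mu X \is a fin_num.
    move=> mX XU; rewrite ge0_fin_numE//.
    apply: (@le_lt_trans _ _ (mu U)); first by apply: le_measure; rewrite ?inE.
    by rewrite muU ltry.
  have VU : V `<=` U by apply: BU; exact: ltnW.
  have fB := fin _ mBk BkU; have fV := fin _ mV VU.
  have fI : mu (V `&` B k) \is a fin_num.
    by apply: fin; [exact: measurableI|move=> x [/VU]].
  have cap : (mu (V `&` B k) <= (k%:R * c)%:E)%E.
    rewrite /V -bigcup_mkord setI_bigcupl bigcup_mkord.
    apply: (@le_trans _ _ (\sum_(i < k) mu (B i `&` B k))%E).
      apply: (content_subadditive mu (F := fun i => B i `&` B k)) => //.
        move=> i /= ik; apply: measurableI => //.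
        by have [] := HB i (leq_trans ik (ltnW km)).
      apply: bigsetU_measurable => i _; apply: measurableI => //.
      by have [] := HB i (leq_trans (ltn_ord i) (ltnW km)).
    apply: (@le_trans _ _ (\sum_(i < k) c%:E)%E).
      by apply: lee_sum => i _; apply/ltW/H.
    by rewrite sumEFin lee_fin sumr_const card_ord -[leLHS]mulr_natl.
  have -> : mu (V `|` B k) = (mu V + mu (B k) - mu (V `&` B k))%E.
    by apply: measureUfinr => //; rewrite -ge0_fin_numE.
  move: IH aBk cap; rewrite -(fineK fB) -(fineK fV) -(fineK fI).
  rewrite -!EFinD !lee_fin => IH aBk cap.
  have -> : (k.+1 ^ 2)%:R = (k ^ 2)%:R + k%:R + k%:R + 1 :> R.
    by rewrite -addn1 !natrX natrD; ring.
  rewrite -addn1 natrD.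
  have : 0 <= (k%:R + 1) * c by rewrite mulr_ge0// addr_ge0.
  by nra.
have := key m (leqnn m).
have fm : mu (\big[setU/set0]_(i < m) B i) \is a fin_num.
  rewrite ge0_fin_numE//; apply: (@le_lt_trans _ _ (mu U)); last by rewrite muU ltry.
  by apply: le_measure; rewrite ?inE; [exact: mB| |exact: BU].
have : (mu (\big[setU/set0]_(i < m) B i) <= u%:E)%E.
  by rewrite -muU; apply: le_measure; rewrite ?inE; [exact: mB| |exact: BU].
rewrite -(fineK fm) -!EFinD !lee_fin; lra.
Qed.

End overlap.

Section sums.
Context {R : realType}.
Local Notation mu := (@lebesgue_measure R).

Lemma measure_gt0_nonempty (A : set R) (c : R) : 0 < c -> (c%:E <= mu A)%E -> A !=set0.
Proof.
move=> c0 cA; apply/set0P/eqP => A0.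
by move: cA; rewrite A0 measure0 lee_fin leNgt c0.
Qed.

(** At a density point x of A, both A and its reflection d - A fill most of a
    small interval about x as soon as d is close to 2 x, so that they meet. *)
Lemma sum_meets_dense (A D : set R) : measurable A -> mu A != 0%E ->
  (forall a b : R, a < b -> exists2 d, D d & a < d < b) ->
  exists x z, [/\ A x, A z & D (x + z)].
Proof.
move=> mA A0 dD.
have [x [Ax densx]] : exists x, A x /\
    (mu (A `&` ball x r) * (mu (ball x r))^-1)%E @[r --> 0^'+] --> (\1_A x)%:E.
  apply: contrapT => /forallNP H.
  move/eqP: A0; apply; apply/negligibleP => //.
  apply: negligibleS (lebesgue_density mA) => y Ay /= Hy.
  by apply: (H y).
rewrite indicE mem_set// in densx.
have [r r0 Hr] : exists2 r : R, 0 < r & ((7/4 * r)%:E <= mu (A `&` ball x r))%E.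
  have /densx : nbhs (1%:E : \bar R) [set y | ((7/8)%:E < y)%E].
    apply: open_nbhs_nbhs; split; first exact: open_ereal_gt_ereal.
    by rewrite /= lte_fin; lra.
  case => e /= e0 He.
  exists (e/2); first by rewrite divr_gt0.
  have := He (e/2); rewrite /= sub0r normrN gtr0_norm ?divr_gt0// gtr_pMr//.
  rewrite invf_lt1// ltr1n => /(_ isT isT).
  rewrite lebesgue_measure_ball; last by rewrite divr_ge0// ltW.
  have e20 : 0 < e/2 *+ 2 :> R by rewrite pmulrn_lgt0// divr_gt0.
  rewrite inver gt_eqF// muleC lte_pdivlMl// => /ltW; apply: le_trans.
  by rewrite -EFinM lee_fin mulr2n; nra.
have [d Dd /andP[d1 d2]] := dD (2*x - r/2) (2*x + r/2) ltac:(lra).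
have mAb : measurable (A `&` ball x r) by apply: measurableI => //; exact: measurable_ball.
pose B i := if i is 0%N then A `&` ball x r else (fun y => d - y) @^-1` (A `&` ball x r).
have := @pairwise_overlap R B (ball x (3/2*r)) (7/4*r) (3*r) (r/10) 2.
case.
- exact: measurable_ball.
- by rewrite lebesgue_measure_ball; [congr (_%:E); rewrite mulr2n; lra|lra].
- case => [_|[_|//]]; split => //=.
  + move=> y [_]; rewrite /ball/= => /lt_le_trans; apply; lra.
  + by rewrite -[X in measurable X]setTI; apply: (measurable_flip d).
  + move=> y [_]; rewrite /ball/= !ltr_norml => /andP[? ?]; apply/andP; split; lra.
  + by rewrite lebesgue_measure_flip.
- lra.
- rewrite [(2 ^ 2)%:R](_ : _ = 4) //; lra.
move=> [|[|i]] [[|[|j]]] [] // _ _ /measure_gt0_nonempty[|y [[Ay _] [Az _]]]; first lra.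
by exists y, (d - y); split => //; rewrite addrC subrK.
Qed.

End sums.

(** * Sums of reciprocals of sines along an orbit *)

Section sine.
Context {R : realType}.
Local Notation mu := (@lebesgue_measure R).

(** sin y = 2 sin (y/2) cos (y/2) and sin (y/2) >= (y/2) cos (y/2) by the mean
    value theorem, while 2 cos (y/2)^2 = 1 + cos y >= 1. *)
Lemma sin_ge_half (y : R) : 0 <= y <= pi / 2 -> y / 2 <= sin y.
Proof.
move=> /andP[y0 ypi].
have [->|yn0] := eqVneq y 0; first by rewrite sin0 mul0r.
have yp : 0 < y by rewrite lt_def yn0.
have pi0 := pi_gt0 R.
have [c] : exists2 c, c \in `]0, y / 2[ & sin (y/2) - sin 0 = cos c * (y/2 - 0).
  apply: MVT; first lra.
  by apply: continuous_subspaceT => x; exact: continuous_sin.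
rewrite in_itv/= => /andP[c0 cy]; rewrite sin0 !subr0 => sE.
have cc : cos (y/2) <= cos c.
  by rewrite ltW// ltr_cos// ?in_itv/=; apply/andP; split; lra.
have c20 : 0 <= cos (y/2) by apply: cos_ge0_pihalf; apply/andP; split; lra.
have cy0 : 0 <= cos y by apply: cos_ge0_pihalf; apply/andP; split; lra.
have yE : y = (y/2) *+ 2 by rewrite mulr2n; lra.
have := cos_mulr2n (y/2); rewrite -yE => cE.
have sE2 := sin_mulr2n (y/2); rewrite -yE mulr2n in sE2.
rewrite sE2 sE.
have : (cos (y/2)) ^+ 2 * y <= cos (y/2) * cos c * y.
  by rewrite expr2 ler_wpM2r// ler_wpM2l.
have : 1 <= (cos (y/2)) ^+ 2 *+ 2 by lra.
rewrite mulr2n => h1 h2.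
have : y <= ((cos (y/2)) ^+ 2 + (cos (y/2)) ^+ 2) * y by rewrite ler_peMl// ltW.
nra.
Qed.

Lemma abs_sin_pi_ge (t : R) : `|t| <= 1/2 -> `|t| <= `|sin (pi * t)|.
Proof.
move=> t12; have pi2 := pi_ge2 R.
have -> : `|sin (pi * t)| = `|sin (pi * `|t|)|.
  by have [//|t0] := ger0P t; rewrite mulrN sinN normrN.
have t0 := normr_ge0 t.
apply: le_trans (ler_norm _).
have /sin_ge_half : 0 <= pi * `|t| <= pi / 2 by apply/andP; split; nra.
by apply: le_trans; nra.
Qed.

Lemma abs_sin_pi_int (t : R) (m : int) :
  `|sin (pi * (t + m%:~R))| = `|sin (pi * t)|.
Proof.
have nat_case (s : R) (n : nat) : `|sin (pi * (s + n%:R))| = `|sin (pi * s)|.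
  elim: n => [|n IH]; first by rewrite addr0.
  by rewrite -natr1 addrA mulrDr mulr1 sinDpi normrN.
case: m => n; first exact: nat_case.
by rewrite NegzE mulrNz -[in RHS](subrK (n.+1%:R) t) nat_case.
Qed.

Definition slab (w b r : R) : set R :=
  [set x | 0 <= x < 1 /\ (`|sin (pi * (w * x - b))| <= r)%R].

Lemma measurable_abs_sin (w b : R) :
  measurable_fun [set: R] (fun x => `|sin (pi * (w * x - b))|).
Proof.
apply: measurableT_comp => //; apply: continuous_measurable_fun => x.
apply: (@continuous_comp _ _ _ (fun x => pi * (w * x - b)) sin); last exact: continuous_sin.
by apply: cvgM; [exact: cvg_cst|apply: cvgB; [apply: cvgM; [exact: cvg_cst|exact: cvg_id]|exact: cvg_cst]].
Qed.

Lemma measurable_slab w b r : measurable (slab w b r).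
Proof.
rewrite (_ : slab w b r = `[0, 1[%classic `&`
   (fun x => `|sin (pi * (w * x - b))|) @^-1` `]-oo, r]%classic).
  apply: measurableI => //.
  by rewrite -[X in measurable X]setTI; exact: (measurable_abs_sin w b).
by apply/seteqP; split => x /=; rewrite /slab/= ?in_itv/=.
Qed.

(** The set is covered by boundedly many intervals of length O(r), one around each
    zero (m + b) / w of the sine.  The constant is uniform in the phase b, so that
    one estimate serves all the points x + k of an orbit. *)
Lemma slab_measure (w : R) : w != 0 -> exists2 C, 0 < C &
  forall b r, 0 < r -> (mu (slab w b r) <= (C * r)%:E)%E.
Proof.
move=> w0; have nw0 : 0 < `|w| by rewrite normr_gt0.
pose M := (Num.truncn (2 * `|w|)).+4.
exists (4 * M%:R / `|w|); first by rewrite divr_gt0// mulr_gt0// ltr0n.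
move=> b r r0.
(* For x in [0, 1[ the integer nearest to w x - b is one of m0, ..., m0 + M - 1. *)
pose m0 := Num.floor (- b - `|w|).
pose F (i : nat) : set R := ball (((m0 + i%:Z)%:~R + b) / w) (2 * r / `|w|).
have rw : 0 < 2 * r / `|w| by rewrite divr_gt0// mulr_gt0.
have sub : slab w b r `<=` \big[setU/set0]_(i < M) F i.
  move=> x [/= /andP[x0 x1] xr].
  set t := w * x - b in xr.
  pose m := Num.floor (t + 1/2).
  have mle : m%:~R <= t + 1/2 by exact: floor_le.
  have mgt : t + 1/2 < m%:~R + 1 by have := floorD1_gt (t + 1/2); rewrite intrD.
  have m0le : m0%:~R <= - b - `|w| by exact: floor_le.
  have m0gt : - b - `|w| < m0%:~R + 1 by have := floorD1_gt (- b - `|w|); rewrite intrD.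
  have twx : `|w * x| <= `|w|.
    by rewrite normrM ler_piMr// ger0_norm// ltW.
  have /andP[tw1 tw2] : - `|w| <= w * x <= `|w| by rewrite -ler_norml.
  have tm : `|t - m%:~R| <= r.
    have : `|t - m%:~R| <= 1/2 by rewrite ler_norml; apply/andP; split; lra.
    move=> /abs_sin_pi_ge/le_trans; apply.
    by rewrite -mulrNz abs_sin_pi_int.
  have m0m : m0 <= m by rewrite /m0 /m; apply: le_floor; rewrite /t; lra.
  have [i mE] : exists i : nat, m = m0 + i%:Z.
    by exists `|(m - m0)%R|%N; rewrite gez0_abs ?subr_ge0// [RHS]addrC subrK.
  have iM : (i < M)%N.
    rewrite -(ltr_nat R) /M.
    have := truncnS_gt (2 * `|w|).
    move: mle; rewrite mE intrD -pmulrn /t => mle.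
    rewrite -[(Num.truncn _).+4]addn3 natrD; lra.
  rewrite -bigcup_mkord; exists i => //.
  rewrite /F/ball/= -mE.
  have -> : (m%:~R + b) / w - x = - ((t - m%:~R) / w).
    by rewrite /t; field.
  rewrite normrN normrM normfV; apply: (@le_lt_trans _ _ (r / `|w|)).
    by rewrite ler_pM2r ?invr_gt0.
  by rewrite ltr_pM2r ?invr_gt0//; lra.
apply: (@le_trans _ _ (\sum_(i < M) mu (F i))%E).
  apply: content_subadditive => //; last exact: measurable_slab.
  by move=> i _; exact: measurable_ball.
under eq_bigr => i _ do rewrite lebesgue_measure_ball ?(ltW rw)//.
rewrite sumEFin lee_fin sumr_const card_ord -[leLHS]mulr_natl mulr2n.
by rewrite le_eqVlt; apply/orP; left; apply/eqP; field; rewrite normr_eq0.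
Qed.

End sine.

Section reciprocal.
Context {R : realType}.
Local Notation mu := (@lebesgue_measure R).

Lemma weighted_markov (I : finType) (S : I -> set R) (w : I -> R) (V K : R) :
  (forall i, measurable (S i)) -> (forall i, 0 <= w i) ->
  (\sum_i (w i)%:E * mu (S i) <= V%:E)%E -> 0 < K ->
  let g := fun x => \sum_i w i * \1_(S i) x in
  measurable [set x | K <= g x] /\
  (mu [set x | (K <= g x)%R] <= (V / K)%:E)%E.
Proof.
move=> mS w0 HV K0 g.
have mg : measurable_fun [set: R] g.
  apply: measurable_sum => i; apply: measurable_funM => //; exact: measurable_indic.
have g0 x : 0 <= g x.
  by apply: sumr_ge0 => i _; rewrite mulr_ge0// indicE.
split.
  rewrite (_ : mkset _ = g @^-1` `[K, +oo[%classic).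
    by rewrite -[X in measurable X]setTI; exact: mg.
  by apply/seteqP; split => x /=; rewrite in_itv/= andbT.
have := @le_integral_comp_abse _ _ _ mu _ measurableT (EFin \o g) K id.
move=> /(_ (@measurable_id _ _ _) (fun r h => h) (fun _ _ _ _ h => h)).
move=> /(_ (measurableT_comp (@EFin_measurable _ setT) mg) K0).
rewrite setTI.
have -> : [set x | (K%:E <= `|(EFin \o g) x|)%E] = [set x | K <= g x].
  by apply/seteqP; split => x /=; rewrite lee_fin ger0_norm.
move=> H.
rewrite -(@lee_pmul2l _ K%:E)// -EFinM mulrCA divff ?gt_eqF// mulr1.
apply: (le_trans H); apply: le_trans HV.
under eq_integral => x _.
  rewrite /= ger0_norm//.
  rewrite -sumEFin.
  under eq_bigr => i _ do rewrite EFinM.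
  over.
rewrite ge0_integral_sum//.
- apply: lee_sum => i _; rewrite ge0_integralZl_EFin//.
  + rewrite integral_indic//; last exact: mS.
    by rewrite (_ : S i `&` _ = S i)//; exact: setIT.
  + by apply: measurableT_comp => //; exact: (measurable_indic (mS i)).
- move=> i; apply: measurable_funeM; apply: measurableT_comp => //.
  exact: (measurable_indic (mS i)).
- by move=> i x _; rewrite lee_fin mulr_ge0// indicE.
Qed.

End reciprocal.

Section reciprocal_sum.
Context {R : realType}.
Local Notation mu := (@lebesgue_measure R).

(** The layer of index j accounts for the points with s in ]2^-(j+1), 2^-j]. *)
Lemma dyadic_layers (s : R) (J : nat) : 2 ^- J < s <= 1 ->
  s^-1 <= \sum_(j < J) 2 ^+ j.+1 * (s <= 2 ^- j)%R%:R.
Proof.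
elim: J => [|J IH] /andP[Js s1].
  by move: Js; rewrite expr0 invr1 ltNge s1.
rewrite big_ord_recr/=; have [sJ|Jls] := leP s (2 ^- J).
  rewrite mulr1 ler_wpDl//.
    by apply: sumr_ge0 => i _; rewrite mulr_ge0// exprn_ge0.
  by rewrite -[leRHS]invrK lef_pV2 ?posrE ?invr_gt0 ?exprn_gt0 ?ltW// (lt_trans _ Js)// invr_gt0 exprn_gt0.
by rewrite mulr0 addr0; apply: IH; rewrite Jls.
Qed.

(** The logarithm that matches the one in the Diophantine hypothesis.  Off the set
    where some sine is below about 1/N, which has small measure, each reciprocal is a
    sum of about log N dyadic layers, and every layer has mean O(1) by slab_measure;
    Markov's inequality then bounds the sum of the N reciprocals by O(N log N). *)
Lemma reciprocal_sum (w c : R) : w != 0 -> 0 < c -> exists2 K, 0 < K &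
  forall b (N : nat), (0 < N)%N -> exists E : set R,
    [/\ measurable E, (mu E <= c%:E)%E &
      forall x, 0 <= x < 1 -> ~ E x ->
        (forall k, (k < N)%N -> 0 < `|sin (pi * (w * (x + k%:R) - b))|) /\
        \sum_(k < N) `|sin (pi * (w * (x + k%:R) - b))|^-1
          <= K * (N%:R * (1 + ln N%:R))].
Proof.
move=> w0 c0; have [C C0 HC] := slab_measure w w0.
pose M0 := (Num.truncn (2 * C / c)).+1.
have M0gt : 2 * C / c < M0%:R by exact: truncnS_gt.
have ln2 : 0 < ln 2 :> R by rewrite ln_gt0// ltr1n.
have lnM0 : 0 <= ln M0%:R :> R by rewrite ln_ge0// ler1n.
exists (4 * C / c * (1 + (1 + ln M0%:R) / ln 2)).
  by rewrite mulr_gt0// ?divr_gt0 ?mulr_gt0// addr_gt0// divr_gt0// ltr_wpDr.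
move=> b N N0.
have lnN : 0 <= ln N%:R :> R by rewrite ln_ge0// ler1n.
(* The slabs of width 2^-J, of order c / (C N), have total measure at most c / 2. *)
pose J := (trunc_log 2 (N * M0)).+1.
have NM0 : (0 < N * M0)%N by rewrite muln_gt0 N0.
have J1 : N%:R * M0%:R < 2 ^+ J :> R.
  by rewrite -natrM -natrX ltr_nat; exact: trunc_log_ltn.
have J2 : J%:R <= (1 + (1 + ln M0%:R) / ln 2) * (1 + ln N%:R) :> R.
  have : (trunc_log 2 (N * M0))%:R * ln 2 <= ln N%:R + ln M0%:R :> R.
    rewrite -lnM ?posrE ?ltr0n// mulr_natl -lnXn//.
    rewrite ler_ln ?posrE ?exprn_gt0 ?mulr_gt0 ?ltr0n//.
    by rewrite -natrM -natrX ler_nat; exact: trunc_logP.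
  rewrite -ler_pdivlMr// => h.
  rewrite /J -natr1; apply: le_trans (lerD h (lexx 1)) _.
  have i2 : 0 < (ln 2)^-1 :> R by rewrite invr_gt0.
  have h1 : 0 <= (ln 2)^-1 * ln N%:R * ln M0%:R :> R by rewrite !mulr_ge0// ltW.
  have h2 : 0 <= (ln 2)^-1 :> R by exact: ltW.
  lra.
pose s (k : nat) (x : R) : R := `|sin (pi * (w * (x + k%:R) - b))|.
pose S (k : nat) r := slab w (b - w * k%:R) r.
have SE k r x : 0 <= x < 1 -> S k r x <-> s k x <= r.
  move=> x01; rewrite /S /slab/= /s.
  rewrite (_ : w * x - (b - w * k%:R) = w * (x + k%:R) - b); last by ring.
  by split => [[]|].
pose V := 2 * C * N%:R * J%:R.
have V0 : 0 < V by rewrite !mulr_gt0// ltr0n.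
pose g (x : R) : R := \sum_(i : 'I_N * 'I_J) 2 ^+ (i.2).+1 * \1_(S i.1 (2 ^- i.2)) x.
have [mE2 E2c] : measurable [set x | V / (c / 2) <= g x] /\
    (mu [set x | (V / (c / 2) <= g x)%R] <= (V / (V / (c / 2)))%:E)%E.
  apply: (@weighted_markov R ('I_N * 'I_J)%type
    (fun i => S i.1 (2 ^- i.2)) (fun i => 2 ^+ (i.2).+1) V (V / (c / 2))).
  - by move=> i; exact: measurable_slab.
  - by move=> i; rewrite exprn_ge0.
  - apply: (@le_trans _ _ (\sum_(i : 'I_N * 'I_J) (2 * C)%:E)%E).
      apply: lee_sum => i _.
      apply: (@le_trans _ _ ((2 ^+ i.2.+1)%:E * (C * 2 ^- i.2)%:E)%E).
        rewrite lee_pmul2l// ?lte_fin ?exprn_gt0//; apply: HC.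
        by rewrite invr_gt0 exprn_gt0.
      by rewrite -EFinM lee_fin exprS -mulrA [X in 2 * X]mulrCA divff ?mulr1// expf_neq0.
    rewrite sumEFin lee_fin sumr_const card_prod !card_ord -[leLHS]mulr_natr natrM.
    by rewrite /V mulrA.
  - by rewrite !divr_gt0.
exists (\big[setU/set0]_(k < N) S k (2 ^- J) `|` [set x | (V / (c / 2) <= g x)%R]).
have mE1 : measurable (\big[setU/set0]_(k < N) S k (2 ^- J)).
  by apply: bigsetU_measurable => k _; exact: measurable_slab.
split.
- exact: measurableU.
- apply: (@le_trans _ _ ((c / 2)%:E + (c / 2)%:E)%E); last first.
    by rewrite -EFinD lee_fin; lra.
  apply: (le_trans (measureU2 mu mE1 mE2)).
  apply: leeD; last first.
    by apply: (le_trans E2c); rewrite lee_fin invf_div mulrCA divff ?mulr1// gt_eqF.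
  apply: (@le_trans _ _ (\sum_(k < N) mu (S k (2 ^- J)))%E).
    apply: (content_subadditive mu (F := fun k => S k (2 ^- J))) => // k _.
    exact: measurable_slab.
  apply: (@le_trans _ _ (\sum_(k < N) (C * 2 ^- J)%:E)%E).
    by apply: lee_sum => k _; apply: HC; rewrite invr_gt0 exprn_gt0.
  rewrite sumEFin lee_fin sumr_const card_ord -[leLHS]mulr_natr.
  rewrite mulrAC ler_pdivrMr ?exprn_gt0//.
  have : C * N%:R <= c / 2 * (N%:R * M0%:R).
    move: M0gt; rewrite ltr_pdivrMr// => /ltW M0gt.
    have : 0 <= N%:R :> R by [].
    nra.
  by move/le_trans; apply; rewrite ler_pM2l ?divr_gt0// ltW.
move=> x x01 /not_orP[nE1 nE2].
have sJ k : (k < N)%N -> 2 ^- J < s k x.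
  move=> kN; rewrite ltNge; apply/negP => h; apply: nE1.
  by rewrite -(bigcup_mkord N (fun k => S k (2 ^- J))); exists k => //; exact/SE.
split.
  by move=> k /sJ; apply: le_lt_trans; rewrite invr_ge0 exprn_ge0.
apply: (@le_trans _ _ (g x)).
  rewrite /g -(pair_bigA _ (fun (k : 'I_N) (j : 'I_J) =>
    2 ^+ j.+1 * \1_(S k (2 ^- j)) x))/=.
  apply: ler_sum => k _; apply: (le_trans (dyadic_layers _ J _)).
    rewrite sJ//=; rewrite ler_norml sin_geN1 sin_le1 //.
  apply: ler_sum => j _; rewrite indicE ler_wpM2l ?exprn_ge0//.
  rewrite ler_nat; case: leP => // h.
  by rewrite mem_set//; exact/SE.
move/negP: nE2; rewrite -ltNge => /ltW/le_trans; apply.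
rewrite /V invf_div.
have -> : 2 * C * N%:R * J%:R * (2 / c) = 4 * C / c * N%:R * J%:R by ring.
apply: (@le_trans _ _ (4 * C / c * N%:R * ((1 + (1 + ln M0%:R) / ln 2) * (1 + ln N%:R)))).
  by rewrite ler_wpM2l// mulr_ge0// divr_ge0// ?mulr_ge0// ltW.
by rewrite le_eqVlt; apply/orP; left; apply/eqP; ring.
Qed.

End reciprocal_sum.

(** * Orbits under the unit translation *)

Section orbits.
Context {R : realType}.
Local Notation mu := (@lebesgue_measure R).

(** The features of x |-> |d + d' e(w x)| that the proof uses: p vanishes at most
    like a sine, with phase b, it is Lipschitz, it has period 1 / w, and it is even
    about b / w. *)
Definition sine_like (w : R) (p : R -> R) : Prop := exists b c L : R,
  [/\ 0 < c, 0 <= L,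
      forall x, c * `|sin (pi * (w * x - b))| <= p x,
      forall x h, p (x + h) <= p x + L * `|h| &
      (forall x, p (x + w^-1) = p x) /\ (forall x, p (2 * b / w - x) = p x)].

Lemma sine_like_ge0 w p x : sine_like w p -> 0 <= p x.
Proof.
by move=> [b [c [L [c0 _ cp _ _]]]]; apply: le_trans (cp x); rewrite mulr_ge0// ltW.
Qed.

Lemma sine_like_period w p (m : int) x : sine_like w p -> p (x + m%:~R / w) = p x.
Proof.
move=> [_ [_ [_ [_ _ _ _ [per _]]]]].
have nat_case (n : nat) y : p (y + n%:R / w) = p y.
  elim: n => [|n IH]; first by rewrite mul0r addr0.
  by rewrite -natr1 mulrDl mul1r addrA per.
case: m => n; first exact: nat_case.
by rewrite NegzE mulrNz mulNr -[in RHS](subrK (n.+1%:R / w) x) nat_case.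
Qed.

Lemma sine_like_neq0 w p : w != 0 -> sine_like w p -> {ae mu, forall x, p x != 0}.
Proof.
move=> w0 [b [c [_ [c0 _ cp _ _]]]].
have cZ : countable (range (fun m : int => (m%:~R + b) / w)).
  exact: card_le_trans (card_image_le _ _) (countableP _).
exists (range (fun m : int => (m%:~R + b) / w)); split.
- by apply: countable_measurable => // t; exact: measurable_set1.
- exact: countable_lebesgue_measure0.
- move=> x /= /negP/negPn/eqP px0.
  have sx0 : `|sin (pi * (w * x - b))| = 0.
    apply/eqP; rewrite eq_le normr_ge0 andbT -(pmulr_rle0 _ c0).
    by rewrite -px0.
  pose t := w * x - b.
  pose m := Num.floor (t + 1/2).
  have mle : m%:~R <= t + 1/2 by exact: floor_le.
  have mgt : t + 1/2 < m%:~R + 1 by have := floorD1_gt (t + 1/2); rewrite intrD.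
  have : `|t - m%:~R| <= 1/2 by rewrite ler_norml; apply/andP; split; lra.
  move=> /abs_sin_pi_ge; rewrite -mulrNz abs_sin_pi_int sx0 normr_le0 mulrNz subr_eq0.
  move=> /eqP tm; exists m => //; rewrite -tm /t; field.
  exact: w0.
Qed.

Lemma telescope (p q u : R -> R) x (N : nat) :
  (forall n : int, q (x + n%:~R) * u (x + n%:~R + 1) = p (x + n%:~R) * u (x + n%:~R)) ->
  u (x + N%:R) * \prod_(k < N) q (x + k%:R) = u x * \prod_(k < N) p (x + k%:R).
Proof.
move=> H; elim: N => [|N IH]; first by rewrite !big_ord0 addr0.
rewrite !big_ord_recr/= !mulrA -IH.
have /= := H N%:Z; rewrite -natr1 addrA => HN.
by rewrite mulrAC [u _ * q _]mulrC HN; ring.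
Qed.

(** Along x + Z the relation can be iterated and divided by its coefficients, and
    u tends to 0 in both directions; almost every x is of this kind. *)
Definition good_orbit (p q u : R -> R) (x : R) : Prop :=
  [/\ forall n : int, q (x + n%:~R) * u (x + n%:~R + 1) = p (x + n%:~R) * u (x + n%:~R),
      forall n : int, p (x + n%:~R) != 0 /\ q (x + n%:~R) != 0 &
      forall e, 0 < e -> exists M : nat, forall n : int, (M <= `|n|)%N ->
        u (x + n%:~R) <= e].

Lemma good_orbit_shift p q u x (n : int) :
  good_orbit p q u x -> good_orbit p q u (x + n%:~R).
Proof.
have E (k : int) : x + n%:~R + k%:~R = x + (n + k)%:~R by rewrite intrD addrA.
case=> H1 H2 H3; split => [k|k|e e0]; rewrite ?E//.
have [M HM] := H3 _ e0; exists (M + `|n|)%N => k Mk; rewrite E; apply: HM; lia.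
Qed.

(** The coefficients do not vanish, so a zero of u propagates along the orbit in
    both directions. *)
Lemma good_orbit_eq0 p q u x (n : int) :
  good_orbit p q u x -> u (x + n%:~R) = 0 -> u x = 0.
Proof.
have fwd y (N : nat) : good_orbit p q u y -> u (y + N%:R) = 0 -> u y = 0.
  move=> [H1 H2 _] uN; have := @telescope p q u y N H1.
  rewrite uN mul0r => /esym/eqP; rewrite mulf_eq0 => /orP[/eqP//|].
  by move=> /prodf_eq0[k _ /eqP pk]; have [+ _] := H2 k%:Z; rewrite pk eqxx.
have bwd y (N : nat) : good_orbit p q u y -> u y = 0 -> u (y + N%:R) = 0.
  move=> [H1 H2 _] uN; have := @telescope p q u y N H1.
  rewrite uN mul0r => /eqP; rewrite mulf_eq0 => /orP[/eqP//|].
  by move=> /prodf_eq0[k _ /eqP pk]; have [_ +] := H2 k%:Z; rewrite pk eqxx.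
move=> g; case: n => N; first exact: fwd.
rewrite NegzE mulrNz => u0; rewrite -(subrK N.+1%:R x); apply: bwd => //.
by have := @good_orbit_shift _ _ _ _ (- N.+1%:Z) g; rewrite mulrNz.
Qed.

(** A quantitative form of: u is bounded below on a set of positive measure, and
    decays uniformly on most of it.  The bounds e and a are fixed before eta, because
    the number of translates in the pigeonhole argument depends on a, and eta has to be
    chosen small in terms of that number. *)
Lemma persistent_set (p q u : R -> R) : measurable_fun [set: R] u -> (forall x, 0 <= u x) ->
  {ae mu, forall x, good_orbit p q u x} -> ~ {ae mu, forall x, u x = 0} ->
  exists e a : R, [/\ 0 < e, 0 < a & forall eta, 0 < eta -> exists (n0 : nat) (A : set R),
    [/\ measurable A, (a%:E <= mu A)%E &
      forall x, A x -> [/\ 0 <= x < 1, e <= u x, good_orbit p q u x &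
         forall n : int, (n0 <= `|n|)%N -> u (x + n%:~R) <= eta]]].
Proof.
move=> mu_u u0 good nz.
pose A0 (k : nat) : set R := `[0, 1[%classic `&` u @^-1` `[k.+1%:R^-1, +oo[%classic.
have mpre (X : set R) : measurable X -> measurable (u @^-1` X).
  by move=> mX; rewrite -[X in measurable X]setTI; exact: mu_u.
have mA0 k : measurable (A0 k) by apply: measurableI => //; exact: mpre.
(* If u vanished a.e. on [0, 1[, it would do so on almost every orbit. *)
have [k0 A0k] : exists k, mu (A0 k) != 0%E.
  apply: contrapT => /forallNP H; apply: nz.
  have neg : mu.-negligible (\bigcup_k A0 k).
    apply: negligible_bigcup => k; apply/(negligibleP mu (mA0 k)).
    by apply/eqP/negPn/negP; exact: H.
  have ae1 : {ae mu, forall x, ~ (\bigcup_k A0 k) x}.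
    by apply: negligibleS neg => x /= /contrapT.
  apply: ae_impl (ae_and _ _ good (ae_shift_int _ ae1)) => x [gx Hx].
  have [u0x|upos] := ltP 0 (u (x + (- Num.floor x)%:~R)); last first.
    by apply: (good_orbit_eq0 _ _ _ _ _ gx); apply/eqP; rewrite eq_le u0 andbT; exact: upos.
  exfalso; apply: (Hx (- Num.floor x)).
  exists (Num.truncn (u (x + (- Num.floor x)%:~R))^-1) => //.
  split => /=; rewrite in_itv/=.
    have := floor_le x; have := floorD1_gt x; rewrite intrD mulrNz.
    by move=> *; apply/andP; split; lra.
  rewrite andbT -[leRHS]invrK lef_pV2 ?posrE ?invr_gt0 ?ltr0n//.
  by apply/ltW; exact: truncnS_gt.
pose A1 : set R := A0 k0; have mA1 : measurable A1 := mA0 k0.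
have fA1 : mu A1 \is a fin_num.
  rewrite ge0_fin_numE//; apply: (@le_lt_trans _ _ (mu `[0, 1[%classic)).
    by apply: le_measure; rewrite ?inE//; exact: subIsetl.
  by rewrite lebesgue_measure_itv/= lte_fin ltr01 -EFinB ltry.
have A1pos : 0 < fine (mu A1).
  by rewrite fine_gt0// lt_neqAle eq_sym A0k measure_ge0/= -ge0_fin_numE.
exists k0.+1%:R^-1, (fine (mu A1) / 2); split => //.
  by rewrite divr_gt0.
move=> eta eta0.
pose U (N : nat) (n : int) : set R := if (N <= `|n|)%N then
   (fun x => u (x + n%:~R)) @^-1` `]-oo, eta]%classic else setT.
pose A2 (N : nat) : set R := A1 `&` \bigcap_k
   (if (unpickle k : option int) is Some n then U N n else setT).
have mU N n : measurable (U N n).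
  rewrite /U; case: ifP => // _; rewrite -[X in measurable X]setTI.
  apply: (measurableT_comp mu_u (measurable_shift n%:~R)) => //.
have mA2 N : measurable (A2 N).
  apply: measurableI => //; apply: bigcapT_measurable => k.
  by case: unpickle.
have A2P N x : A2 N x -> A1 x /\ forall n : int, (N <= `|n|)%N -> u (x + n%:~R) <= eta.
  move=> [A1x H]; split => // n Nn; have := H (pickle n) I.
  by rewrite pickleK /U Nn /= in_itv.
have A2I N x : A1 x -> (forall n : int, (N <= `|n|)%N -> u (x + n%:~R) <= eta) -> A2 N x.
  move=> A1x H; split => // k _; case: unpickle => // n; rewrite /U.
  by case: ifP => // /H /=; rewrite in_itv.
have ndA2 : {homo A2 : n m / (n <= m)%N >-> (n <= m)%O}.
  move=> n m nm; apply/subsetPset => x /A2P[A1x H]; apply: A2I => // k mk.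
  by apply: H; exact: leq_trans mk.
have [G [mG G0 HG]] := good.
have mcup : measurable (\bigcup_N A2 N) by exact: bigcupT_measurable.
have cvgA2 := nondecreasing_cvg_mu (mu := mu) mA2 mcup ndA2.
have A1cup : (mu A1 <= mu (\bigcup_N A2 N))%E.
  rewrite -(measureU0 (mu := mu) mcup mG G0); apply: le_measure; rewrite ?inE//.
    exact: measurableU.
  move=> x A1x; have [gx|ngx] := pselect (good_orbit p q u x); last by right; exact: HG.
  left; have [_ _ /(_ _ eta0)[M HM]] := gx.
  by exists M => //; exact: A2I.
have [N HN] : exists N, ((fine (mu A1) / 2)%:E < mu (A2 N))%E.
  have : nbhs (mu (\bigcup_N A2 N)) [set y | ((fine (mu A1) / 2)%:E < y)%E].
    apply: open_nbhs_nbhs; split; first exact: open_ereal_gt_ereal.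
    rewrite /=; apply: (lt_le_trans _ A1cup).
    by rewrite -[ltRHS]fineK// lte_fin; lra.
  by move=> /cvgA2[N _ HN]; exists N; apply: (HN N) => /=.
have mA2G : measurable (A2 N `\` G) by exact: measurableD.
exists N, (A2 N `\` G); split => //.
- apply: (le_trans (ltW HN)).
  rewrite -(measureU0 (mu := mu) mA2G mG G0).
  apply: le_measure; rewrite ?inE; [exact: mA2|exact: (measurableU _ _ mA2G mG)|].
  by move=> x A2x; have [|] := pselect (G x); [right|left].
- move=> x [/A2P[[/= + +] H] nGx]; rewrite !in_itv/= andbT => x01 ux; split => //.
  by apply: contrapT => ngx; apply: nGx; exact: HG.
Qed.

End orbits.

(** * The Diophantine case *)

Section core_a.
Context {R : realType}.
Local Notation mu := (@lebesgue_measure R).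

(** Poincare recurrence for the rotation by T modulo 1, by pigeonhole on the m
    translates of A by the fractional parts of i T.  The exceptional set may depend on
    (i, j), because it depends on the length of the orbit segment used later. *)
Lemma return_pair (A : set R) (E : nat -> nat -> set R) (a T : R) (m : nat) :
  measurable A -> (forall x, A x -> 0 <= x < 1) -> (a%:E <= mu A)%E ->
  3 < m%:R * a -> (forall i j, measurable (E i j)) ->
  (forall i j, (i < j < m)%N -> (mu (E i j) <= ((m ^ 2)%:R^-1 / 2)%:E)%E) ->
  exists (i j : nat) (x z : R), [/\ (i < j < m)%N, A x, A z, ~ E i j x &
    z + (Num.floor (j%:R * T) - Num.floor (i%:R * T))%:~R = x + (j - i)%:R * T].
Proof.
move=> mA A01 aA ma mE Em.
pose fr (i : nat) := i%:R * T - (Num.floor (i%:R * T))%:~R.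
have fr0 i : 0 <= fr i by rewrite subr_ge0 floor_le.
have fr1 i : fr i < 1 by have := floorD1_gt (i%:R * T); rewrite intrD /fr; lra.
pose B (i : nat) : set R := (fun y => y + - fr i) @^-1` A.
have mB i : measurable (B i).
  by rewrite -[X in measurable X]setTI; exact: (measurable_shift (- fr i)).
have m0 : (0 < m)%N.
  by case: m ma {Em} => //; rewrite mul0r ltNge ler0n.
have m20 : 0 < (m ^ 2)%:R :> R by rewrite ltr0n expn_gt0 m0.
case: (@pairwise_overlap R B `[0, 2[%classic a 2 (m ^ 2)%:R^-1 m).
- by [].
- by rewrite lebesgue_measure_itv/= lte_fin ltr0n/= -EFinB subr0.
- move=> i im; split => //.
  + move=> y /A01 /andP[? ?]; rewrite /= in_itv/=; have := fr0 i; have := fr1 i.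
    by move=> *; apply/andP; split; lra.
  + by rewrite lebesgue_measure_shift.
- by rewrite invr_ge0 ltW.
- by rewrite divff ?gt_eqF//; lra.
move=> i [j [ij jm Bij]].
pose X : set R := (fun y => y + fr j) @^-1` (B i `&` B j).
have mX : measurable X.
  rewrite -[X in measurable X]setTI; apply: (measurable_shift (fr j)) => //.
  exact: measurableI.
have muX : ((m ^ 2)%:R^-1%:E <= mu X)%E.
  by rewrite lebesgue_measure_shift//; exact: measurableI.
have [x [[Bix Bjx] nEx]] : exists x, X x /\ ~ E i j x.
  apply: contrapT => /forallNP H.
  have XE : X `<=` E i j.
    by move=> x Xx; apply: contrapT => nE; apply: (H x).
  have XEm : (mu X <= mu (E i j))%E by apply: le_measure; rewrite ?inE//; exact: mE.
  have ijm : (i < j < m)%N by rewrite ij.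
  have := le_trans muX (le_trans XEm (Em i j ijm)).
  rewrite lee_fin; have : 0 < (m ^ 2)%:R^-1 :> R by rewrite invr_gt0.
  lra.
exists i, j, x, (x + fr j - fr i); split => //.
- by rewrite ij.
- by move: Bjx; rewrite /B/= addrK.
- by rewrite /fr natrB ?(ltnW ij)// intrD mulrNz; ring.
Qed.

Lemma prod_le_expR (N : nat) (q q' d : nat -> R) :
  (forall k, (k < N)%N -> 0 <= q' k /\ q' k <= q k * expR (d k)) ->
  \prod_(k < N) q' k <= \prod_(k < N) q k * expR (\sum_(k < N) d k).
Proof.
move=> H; rewrite expR_sum -big_split/=; apply: ler_prod => k _.
by have [-> ->] := H k (ltn_ord k).
Qed.

(** The gain n log n in the approximation compensates the loss N log N of
    reciprocal_sum when N = O(n). *)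
Lemma diophantine_size (D kap : R) : 0 <= D -> 1 <= kap -> exists n1 : nat,
  forall (n N : nat) (del : R), (n1 <= n)%N -> (0 < N)%N -> N%:R <= kap * n%:R ->
    n%:R * ln n%:R * del <= D -> 0 <= del ->
    del * (N%:R * (1 + ln N%:R)) <= D * kap * (2 + ln kap).
Proof.
move=> D0 kap1; exists (Num.truncn (expR 1 : R)).+1 => n N del n1n N0 Nkap Hdel del0.
have kap0 : 0 < kap by rewrite (lt_le_trans _ kap1).
have en : expR 1 < n%:R :> R.
  by apply: (lt_le_trans (truncnS_gt _)); rewrite ler_nat.
have n0 : 0 < n%:R :> R by apply: lt_trans en; exact: expR_gt0.
have lnn : 1 <= ln n%:R :> R.
  by rewrite -[leLHS](expRK 1) ler_ln ?posrE ?expR_gt0// ltW.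
have lnk : 0 <= ln kap by rewrite ln_ge0.
have lnN : ln N%:R <= ln kap + ln n%:R :> R.
  by rewrite -lnM ?posrE// ler_ln ?posrE ?mulr_gt0// ltr0n.
have lnN0 : 0 <= ln N%:R :> R by rewrite ln_ge0// ler1n.
apply: (@le_trans _ _ (del * ((kap * n%:R) * ((2 + ln kap) * ln n%:R)))).
  apply: ler_wpM2l => //; apply: ler_pM => //; first by rewrite addr_ge0.
  nra.
rewrite (_ : _ * _ = (n%:R * ln n%:R * del) * (kap * (2 + ln kap))); last by ring.
rewrite -[leRHS]mulrA; apply: ler_wpM2r => //.
by apply: mulr_ge0; [exact: ltW|lra].
Qed.


(** With l = j - i, the shift l T is an exact period of p and differs from a period
    of q by l del.  The two telescoping products along [x - N, x[ and [z, z + N[ thus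
    share their p factors, and the products of their q factors differ by a factor of at
    most exp M.  Hence
    u(z) u(x) <= u(z + N) u(x - N) exp M, which contradicts the choice of eta. *)
Theorem no_decaying_orbit_diophantine (alpha beta : R) (p q u : R -> R) :
  alpha != 0 -> beta != 0 -> sine_like alpha p -> sine_like beta q ->
  measurable_fun [set: R] u -> (forall x, 0 <= u x) ->
  {ae mu, forall x, good_orbit p q u x} ->
  (exists D, 0 <= D /\ forall n0 : nat, exists (n : nat) (m : int), (n0 <= n)%N /\
     n%:R * ln n%:R * `|n%:R * (beta / alpha) - m%:~R| <= D) ->
  {ae mu, forall x, u x = 0}.
Proof.
move=> a0 b0 sp sq mu_u u0 good [D [D0 HD]]; apply: contrapT => nz.
have [e [a [e0 apos HA]]] := persistent_set _ _ _ mu_u u0 good nz.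
have na : 0 < `|alpha| by rewrite normr_gt0.
have nb : 0 < `|beta| by rewrite normr_gt0.
have [b [c [L [c0 L0 cq Lq [_ _]]]]] := sq.
pose m := (Num.truncn (3 / a)).+1.
have ma : 3 < m%:R * a by rewrite -ltr_pdivrMr//; exact: truncnS_gt.
have m0 : 0 < m%:R :> R by rewrite ltr0n.
have m20 : 0 < (m ^ 2)%:R^-1 / 2 :> R by rewrite divr_gt0// invr_gt0 ltr0n expn_gt0.
have [K K0 HK] := reciprocal_sum _ _ b0 m20.
pose kap : R := m%:R / `|alpha| + 1.
have kap1 : 1 <= kap by rewrite lerDr divr_ge0// ltW.
pose D' := m%:R * D / `|beta|.
have D'0 : 0 <= D' by rewrite divr_ge0// ?mulr_ge0// ltW.
have [n1 Hn1] := diophantine_size _ _ D'0 kap1.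
(* exp M will bound the quotient of the two products of values of q. *)
pose M := L / c * K * (D' * kap * (2 + ln kap)).
pose eta := e * expR (- M).
have eta0 : 0 < eta by rewrite mulr_gt0// expR_gt0.
have [n0 [A [mA aA AP]]] := HA (eta / 2) ltac:(by rewrite divr_gt0).
have [n [m1 [nn Hnm]]] := HD (n1 + (Num.truncn (`|alpha| * (n0%:R + 2))).+1)%N.
pose T : R := n%:R / `|alpha|.
have T0 : n0%:R + 2 < T.
  rewrite /T ltr_pdivlMr// mulrC; apply: (lt_le_trans (truncnS_gt _)).
  by rewrite ler_nat; apply: leq_trans nn; exact: leq_addl.
have npos : 1 <= n%:R :> R.
  by rewrite ler1n; apply: leq_trans nn; rewrite addnS.
(* T is an integer multiple of the period of p; del measures how far it is from
   one of the period of q. *)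
pose m2 : int := (if 0 < alpha then m1 else - m1).
pose del := T - m2%:~R / beta.
have delE : `|del| = `|n%:R * (beta / alpha) - m1%:~R| / `|beta|.
  rewrite -normfV -normrM /del /T /m2.
  have [ap|an] := ltP 0 alpha.
    by rewrite (gtr0_norm ap); congr (Num.norm _); field; rewrite ?a0 ?b0.
  have {}an : alpha < 0 by rewrite lt_neqAle a0.
  rewrite (ltr0_norm an) -normrN; congr (Num.norm _); rewrite mulrNz; field.
  by rewrite ?a0 ?b0 ?oppr_eq0 ?a0.
pose fl (i : nat) := Num.floor (i%:R * T).
pose Nn (i j : nat) : nat := `|(fl j - fl i)%R|%N.
have fl_le (i : nat) : (fl i)%:~R <= i%:R * T by exact: floor_le.
have fl_gt (i : nat) : i%:R * T < (fl i)%:~R + 1.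
  by have := floorD1_gt (i%:R * T); rewrite intrD.
have NE i j : (i < j < m)%N -> [/\ (n0 < Nn i j)%N, (fl j - fl i) = (Nn i j)%:Z &
     (Nn i j)%:R <= kap * n%:R].
  move=> /andP[ij jm].
  have fij : n0%:R < (fl j - fl i)%:~R :> R.
    rewrite intrD mulrNz; have := fl_le i; have := fl_gt j.
    have : i.+1%:R * T <= j%:R * T.
      by rewrite ler_wpM2r ?ler_nat// ltW// (le_lt_trans _ T0)// addr_ge0.
    rewrite -natr1 mulrDl; lra.
  have fE : (fl j - fl i) = (Nn i j)%:Z.
    by rewrite /Nn gez0_abs// -(ler_int R) ltW// (le_lt_trans _ fij)// ler0n.
  split => //; first by rewrite -(ltr_nat R); move: fij; rewrite fE.
  have : (Nn i j)%:R = (fl j - fl i)%:~R :> R by rewrite fE.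
  move=> ->; rewrite intrD mulrNz.
  have fi0 : 0 <= (fl i)%:~R :> R.
    by rewrite ler0z floor_ge0 mulr_ge0// divr_ge0// ltW.
  have := fl_le j.
  have : j%:R * T <= m%:R * T.
    rewrite ler_wpM2r ?ler_nat ?(ltnW jm)//.
    by rewrite divr_ge0// ltW.
  rewrite /kap mulrDl mul1r -mulrA -[_^-1 * _]mulrC -/T.
  lra.
have HE (i j : nat) : exists E : set R, measurable E /\ ((i < j < m)%N ->
    (mu E <= ((m ^ 2)%:R^-1 / 2)%:E)%E /\
    forall x, 0 <= x < 1 -> ~ E x ->
      (forall k, (k < Nn i j)%N ->
         0 < `|sin (pi * (beta * (x + k%:R) - (b + beta * (Nn i j)%:R)))|) /\
      \sum_(k < Nn i j) `|sin (pi * (beta * (x + k%:R) - (b + beta * (Nn i j)%:R)))|^-1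
          <= K * ((Nn i j)%:R * (1 + ln (Nn i j)%:R))).
  have [ijm|nijm] := boolP (i < j < m)%N; last by exists set0; split.
  have [h _ _] := NE i j ijm.
  (* the phase is moved by beta N, since the orbit segment starts at x - N *)
  have [E [mE E1 E2]] := HK (b + beta * (Nn i j)%:R) (Nn i j) (leq_ltn_trans (leq0n _) h).
  by exists E.
pose E i j := projT1 (cid (HE i j)).
have [||i [j [x [z [ijm Ax Az nEx zx]]]]] :=
  return_pair A E a T m mA _ aA ma (fun i j => (projT2 (cid (HE i j))).1).
- by move=> x /AP[].
- by move=> i j ijm; have [+ _] := (projT2 (cid (HE i j))).2 ijm.
have [_ /(_ x)] := (projT2 (cid (HE i j))).2 ijm.
have [N0 flE Nkap] := NE i j ijm.
move: zx; rewrite -/(fl j) -/(fl i) flE.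
set N := Nn i j in N0 flE Nkap *; move=> zx.
have [x01 ex gx ux] := AP x Ax; have [z01 ez gz uz] := AP z Az.
move=> /(_ x01 nEx)[s_pos s_sum].
pose l := (j - i)%N.
have zk k : z + k%:R = x - N%:R + k%:R + l%:R * T.
  have zE : z = x + l%:R * T - N%:R by rewrite -zx addrK.
  by rewrite [in LHS]zE; ring.
have lm : l%:R <= m%:R :> R.
  rewrite ler_nat; case/andP: ijm => _ jm.
  by rewrite /l; apply: leq_trans (leq_subr _ _) (ltnW jm).
have lzx : l%:R * T = (l%:Z * m2)%:~R / beta + l%:R * del.
  by rewrite /del intrM; ring.
have q_z (k : nat) : q (z + k%:R) = q (x - N%:R + k%:R + l%:R * del).
  by rewrite zk lzx addrCA addrC (sine_like_period beta).
have p_z (k : nat) : p (z + k%:R) = p (x - N%:R + k%:R).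
  rewrite zk /T; have [ap|an] := ltP 0 alpha.
    by rewrite gtr0_norm// mulrA -natrM (sine_like_period alpha _ (l * n)%N%:Z).
  have {}an : alpha < 0 by rewrite lt_neqAle a0.
  rewrite ltr0_norm// mulrA -natrM invrN mulrN -mulNr.
  by have := sine_like_period alpha p (- (l * n)%N%:Z) (x - N%:R + k%:R) sp; rewrite mulrNz.
pose ldel := l%:R * `|del|.
have ldel0 : 0 <= ldel by rewrite mulr_ge0.
pose s (k : nat) := `|sin (pi * (beta * (x + k%:R) - (b + beta * N%:R)))|.
have sE (k : nat) : s k = `|sin (pi * (beta * (x - N%:R + k%:R) - b))|.
  by rewrite /s; congr (Num.norm (sin (_ * _))); ring.
pose d (k : nat) := L / c * ldel * (s k)^-1.
have Q'Q : \prod_(k < N) q (z + k%:R) <=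
    \prod_(k < N) q (x - N%:R + k%:R) * expR (\sum_(k < N) d k).
  apply: (prod_le_expR N (fun k => q (x - N%:R + k%:R)) (fun k => q (z + k%:R)) d).
  move=> k kN; split; first exact: (sine_like_ge0 beta).
  rewrite q_z; apply: (le_trans (Lq _ _)); rewrite normrM ger0_norm// -/ldel.
  have qs : c * s k <= q (x - N%:R + k%:R) by rewrite sE.
  have sk0 : 0 < s k by exact: s_pos.
  have d0 : 0 <= d k.
    by apply: mulr_ge0; [apply: mulr_ge0 => //; rewrite divr_ge0// ltW|rewrite invr_ge0 ltW].
  apply: (@le_trans _ _ (q (x - N%:R + k%:R) * (1 + d k))); last first.
    by rewrite ler_wpM2l ?expR_ge1Dx// (sine_like_ge0 beta).
  rewrite mulrDr mulr1 lerD2l.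
  apply: (@le_trans _ _ (c * s k * d k)); last by rewrite ler_wpM2r.
  rewrite le_eqVlt; apply/orP; left; apply/eqP; rewrite /d; field.
  by rewrite !gt_eqF.
have dM : \sum_(k < N) d k <= M.
  rewrite /d -mulr_sumr; apply: (@le_trans _ _ (L / c * ldel * (K * (N%:R * (1 + ln N%:R))))).
    by apply: ler_wpM2l => //; apply: mulr_ge0 => //; rewrite divr_ge0// ltW.
  rewrite /M (_ : L / c * ldel * _ = L / c * K * (ldel * (N%:R * (1 + ln N%:R)))); last by ring.
  apply: ler_wpM2l; first by rewrite mulr_ge0// ?divr_ge0// ltW.
  apply: (Hn1 n) => //.
  - by apply: leq_trans nn; exact: leq_addr.
  - exact: leq_trans N0.
  - rewrite /ldel delE /D'.
    rewrite (_ : _ * _ = l%:R * (n%:R * ln n%:R * `|n%:R * (beta / alpha) - m1%:~R|) / `|beta|); last by ring.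
    rewrite ler_pM2r ?invr_gt0//; apply: ler_pM => //.
    by rewrite !mulr_ge0// ln_ge0.
have M0 : 0 <= M.
  apply: le_trans dM; apply: sumr_ge0 => k _; apply: mulr_ge0.
    by apply: mulr_ge0 => //; rewrite divr_ge0// ltW.
  by rewrite invr_ge0 normr_ge0.
have [gz1 _ _] := gz.
have gxN := good_orbit_shift p q u x (- N%:Z) gx; rewrite mulrNz in gxN.
have [gx1 gx2 _] := gxN.
have tz := telescope p q u z N gz1.
have tx := telescope p q u (x - N%:R) N gx1; rewrite subrK in tx.
have eqP : \prod_(k < N) p (z + k%:R) = \prod_(k < N) p (x - N%:R + k%:R).
  by apply: eq_bigr => k _; rewrite p_z.
rewrite eqP in tz.
set PP := \prod_(k < N) p _ in tz tx.
set QQ := \prod_(k < N) q (x - N%:R + k%:R) in Q'Q tx.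
set Q' := \prod_(k < N) q (z + k%:R) in Q'Q tz.
have PP0 : 0 < PP.
  apply: prodr_gt0 => k _; rewrite lt_neqAle eq_sym (sine_like_ge0 alpha)// andbT.
  by have [+ _] := gx2 k%:Z.
have QQ0 : 0 < QQ.
  apply: prodr_gt0 => k _; rewrite lt_neqAle eq_sym (sine_like_ge0 beta)// andbT.
  by have [_ ] := gx2 k%:Z.
have Q'0 : 0 <= Q' by apply: prodr_ge0 => k _; exact: (sine_like_ge0 beta).
have uzN : u (z + N%:R) <= eta / 2 by apply: (uz N%:Z); exact: ltnW.
have uxN : u (x - N%:R) <= eta / 2.
  by have := ux (- N%:Z); rewrite mulrNz abszN; apply; exact: ltnW.
have etae : eta <= e.
  have eM1 : expR (- M) <= 1 :> R by rewrite -[X in _ <= X]expR0 ler_expR oppr_le0.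
  by rewrite /eta ler_piMr// ltW.
have etaM : eta * expR M = e.
  by rewrite /eta -mulrA -expRD addNr expR0 mulr1.
have h1 : e * PP <= e / 2 * QQ.
  apply: (@le_trans _ _ (u z * PP)); first by rewrite ler_wpM2r// ltW.
  rewrite -tz; apply: (@le_trans _ _ (eta / 2 * (QQ * expR M))).
    apply: ler_pM => //; apply: (le_trans Q'Q); apply: ler_wpM2l; first exact: ltW.
    by rewrite ler_expR.
  have -> : eta / 2 * (QQ * expR M) = (eta * expR M) / 2 * QQ by ring.
  by rewrite etaM.
have h2 : e * QQ <= e / 2 * PP.
  apply: (@le_trans _ _ (u x * QQ)); first by rewrite ler_wpM2r// ltW.
  rewrite tx; apply: ler_pM => //; first exact: ltW.
  by apply: (le_trans uxN); rewrite ler_pM2r ?invr_gt0.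
nra.
Qed.

End core_a.

(** * The rational case *)

Section core_b.
Context {R : realType}.
Local Notation mu := (@lebesgue_measure R).

(** Dirichlet's pigeonhole argument.  The combination is nonzero, for otherwise t
    would be rational. *)
Lemma irrational_small_combination (t e : R) : ~ rational t -> 0 < e ->
  exists l k : int, 0 < `|l%:~R * t + k%:~R| < e.
Proof.
move=> irr e0.
pose K := (Num.truncn e^-1).+1.
have K0 : 0 < K%:R :> R by rewrite ltr0n.
have Ke : K%:R^-1 < e.
  by rewrite -[ltRHS]invrK ltf_pV2 ?posrE ?invr_gt0//; exact: truncnS_gt.
pose fr (i : nat) := i%:R * t - (Num.floor (i%:R * t))%:~R.
have fr0 i : 0 <= fr i by rewrite subr_ge0 floor_le.
have fr1 i : fr i < 1 by have := floorD1_gt (i%:R * t); rewrite intrD /fr; lra.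
have bK (i : nat) : (Num.truncn (K%:R * fr i) < K)%N.
  by rewrite truncn_lt_nat ?mulr_ge0//; rewrite -[ltRHS]mulr1 ltr_pM2l.
pose box (i : 'I_K.+1) : 'I_K := Ordinal (bK i).
have [i [j [ij bij]]] : exists i j : 'I_K.+1, i <> j /\ box i = box j.
  apply: contrapT => H.
  have /leq_card : injective box.
    by move=> i j bij; apply: contrapT => nij; apply: H; exists i, j.
  by rewrite !card_ord ltnn.
exists (i%:Z - j%:Z), (Num.floor (j%:R * t) - Num.floor (i%:R * t)).
have E : (i%:Z - j%:Z)%:~R * t + (Num.floor (j%:R * t) - Num.floor (i%:R * t))%:~R
    = fr i - fr j.
  by rewrite /fr !intrD !mulrNz -!pmulrn; ring.
apply/andP; split.
  rewrite normr_gt0; apply/eqP => H; apply: irr.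
  have ij0 : (i%:Z - j%:Z)%:~R != 0 :> R.
    by rewrite intr_eq0 subr_eq0; apply/eqP => -[] /val_inj.
  exists ((Num.floor (i%:R * t) - Num.floor (j%:R * t))%:Q / (i%:Z - j%:Z)%:Q) => //.
  rewrite fmorph_div !rmorph_int; apply: (mulfI ij0); rewrite mulrC divfK//.
  by move/eqP: H; rewrite addr_eq0 => /eqP ->; rewrite -mulrNz opprB.
rewrite E.
have /andP[h1 h2] := truncn_itv (mulr_ge0 (ltW K0) (fr0 i)).
have /andP[h3 h4] := truncn_itv (mulr_ge0 (ltW K0) (fr0 j)).
have bE : Num.truncn (K%:R * fr i) = Num.truncn (K%:R * fr j) by case: bij.
rewrite bE in h1 h2; apply: lt_trans Ke.
rewrite -(ltr_pM2l K0) divff ?gt_eqF// -[X in X * _]gtr0_norm// -normrM mulrBr.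
move: h2 h4; rewrite -natr1 => h2 h4.
by rewrite ltr_norml; apply/andP; split; lra.
Qed.

Lemma irrational_dense (t a b : R) : ~ rational t -> a < b ->
  exists l k : int, a < l%:~R * t + k%:~R < b.
Proof.
move=> irr ab.
have [l [k]] : exists l k : int, 0 < l%:~R * t + k%:~R < b - a.
  have [l [k /andP[g0 gab]]] := irrational_small_combination t (b - a) irr ltac:(lra).
  have [gp|gn] := ltP 0 (l%:~R * t + k%:~R).
    by exists l, k; rewrite gp; move: gab; rewrite gtr0_norm.
  exists (- l), (- k); rewrite !mulrNz mulNr -opprD.
  by move: g0 gab; rewrite ler0_norm// => -> ->.
set g := _ + _ => /andP[g0 gab].
exists ((Num.floor (a / g) + 1) * l), ((Num.floor (a / g) + 1) * k).
have -> : ((Num.floor (a / g) + 1) * l)%:~R * t + ((Num.floor (a / g) + 1) * k)%:~R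
   = (Num.floor (a / g) + 1)%:~R * g.
  by rewrite /g !intrM; ring.
have h1 := floorD1_gt (a / g); have h2 := floor_le (a / g).
rewrite -ltr_pdivrMr// h1 /=.
rewrite intrD mulrDl mul1r.
have : (Num.floor (a / g))%:~R * g <= a by rewrite -ler_pdivlMr.
lra.
Qed.

Definition orbit_prod (q : R -> R) (M : nat) (x : R) := \prod_(k < M) q (x + k%:R).

Lemma orbit_prod_gt0 p q u w M x : good_orbit p q u x -> sine_like w q ->
  0 < orbit_prod q M x.
Proof.
move=> [_ g _] sq; apply: prodr_gt0 => k _.
by rewrite lt_neqAle eq_sym (sine_like_ge0 w)// andbT; have [_] := g k%:Z.
Qed.

Lemma orbit_prod_sub_gt0 p q u w M x : good_orbit p q u x -> sine_like w q ->
  0 < orbit_prod q M (x - M%:R).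
Proof.
move=> /(good_orbit_shift _ _ _ _ (- M%:Z)); rewrite mulrNz; exact: orbit_prod_gt0.
Qed.

(** The forward product of p over [x, x + M[ equals the backward one over
    [x - M, x[, by periodicity, so p disappears from the product of the two telescoped
    relations. *)
Lemma two_sided_identity p q u x (M : nat) : good_orbit p q u x ->
  (forall y, p (y + M%:R) = p y) ->
  u (x + M%:R) * u (x - M%:R) * orbit_prod q M x =
  u x ^+ 2 * orbit_prod q M (x - M%:R).
Proof.
move=> g per; have [g1 _ _] := g.
have t1 := telescope p q u x M g1.
have := good_orbit_shift _ _ _ _ (- M%:Z) g; rewrite mulrNz => -[g2 _ _].
have t2 := telescope p q u (x - M%:R) M g2; rewrite subrK in t2.
have pE : \prod_(k < M) p (x - M%:R + k%:R) = \prod_(k < M) p (x + k%:R).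
  by apply: eq_bigr => k _; rewrite -per; congr p; ring.
rewrite pE in t2; rewrite /orbit_prod mulrAC t1 expr2 -[RHS]mulrA t2; ring.
Qed.

(** The reflection sends z + k, for 0 <= k < M, to x - 1 - k modulo the period of
    q; the summand 1 accounts for the forward product starting at z itself and the
    backward one ending at x - 1. *)
Lemma orbit_prod_reflect w (b : R) (q : R -> R) (l : int) (M : nat) (x : R) :
  (forall x, q (2 * b / w - x) = q x) -> (forall (m : int) x, q (x + m%:~R / w) = q x) ->
  orbit_prod q M (2 * b / w + 1 + l%:~R / w - x) = orbit_prod q M (x - M%:R).
Proof.
move=> refl per; rewrite /orbit_prod [RHS](reindex_inj rev_ord_inj)/=.
apply: eq_bigr => k _; rewrite -refl -(per l); congr q.
by rewrite natrB//= -natr1; ring.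
Qed.

Theorem no_decaying_orbit_rational (alpha beta : R) (p q u : R -> R) :
  alpha != 0 -> beta != 0 -> sine_like alpha p -> sine_like beta q ->
  measurable_fun [set: R] u -> (forall x, 0 <= u x) ->
  {ae mu, forall x, good_orbit p q u x} -> rational alpha ->
  {ae mu, forall x, u x = 0}.
Proof.
move=> a0 b0 sp sq mu_u u0 good ra; apply: contrapT => nz.
have [e [a [e0 apos HA]]] := persistent_set _ _ _ mu_u u0 good nz.
have [n1 [A [mA aA AP]]] := HA 1 ltr01.
have rat_period (w : R) (g : R -> R) : w != 0 -> sine_like w g -> rational w ->
    exists2 d : nat, (0 < d)%N & forall (i : nat) y, g (y + (i * d)%N%:R) = g y.
  move=> w0 sg [r _ rE].
  exists `|denq r|%N; first by rewrite absz_gt0 denq_neq0.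
  move=> i y; rewrite -(sine_like_period _ _ (i%:Z * numq r) y sg); congr g; congr (_ + _).
  have dE : (`|denq r|%N)%:R = (denq r)%:~R :> R by rewrite -absz_denq.
  have nr0 : (numq r)%:~R != 0 :> R.
    by rewrite intr_eq0 numq_eq0; apply/eqP => r0; move: w0; rewrite -rE r0 rmorph0 eqxx.
  have dr0 : (denq r)%:~R != 0 :> R by rewrite intr_eq0 denq_neq0.
  rewrite -rE /ratr intrM natrM dE; field; exact/andP.
have [d d0 pper] := rat_period alpha p a0 sp ra.
have small x : good_orbit p q u x -> forall eps, 0 < eps -> exists M0 : nat,
    forall M : nat, (M0 <= M)%N -> u (x + M%:R) <= eps /\ u (x - M%:R) <= eps.
  move=> [_ _ H] eps eps0; have [M0 HM0] := H eps eps0.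
  exists M0 => M MM; split; first exact: (HM0 M%:Z).
  by have := HM0 (- M%:Z); rewrite mulrNz abszN; apply.
have [rb|irrb] := pselect (rational beta).
  have [d' d'0 qper] := rat_period beta q b0 sq rb.
  have [x Ax] : A !=set0 by exact: measure_gt0_nonempty aA.
  have [_ ex gx _] := AP x Ax.
  have ux0 : 0 < u x by exact: lt_le_trans ex.
  have [M0 HM] := small x gx (u x / 2) ltac:(by rewrite divr_gt0).
  pose M := (M0 * d' * d)%N.
  have MM0 : (M0 <= M)%N by rewrite /M -mulnA leq_pmulr// muln_gt0 d'0.
  have [h1 h2] := HM M MM0.
  have := two_sided_identity p q u x M gx (pper _).
  have -> : orbit_prod q M (x - M%:R) = orbit_prod q M x.
    have ME : M%:R = (M0 * d * d')%N%:R :> R by rewrite /M mulnAC.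
    by apply: eq_bigr => k _; rewrite -(qper (M0 * d)%N) -ME; congr q; ring.
  move/(mulIf (lt0r_neq0 (orbit_prod_gt0 _ _ _ _ M _ gx sq))) => E.
  have := ler_pM (u0 _) (u0 _) h1 h2; rewrite E expr2; nra.
have irrV : ~ rational (beta^-1).
  move=> [r _ rE]; apply: irrb; exists r^-1 => //.
  have -> : ratr r^-1 = (ratr r)^-1 :> R by exact: fmorphV.
  by rewrite rE invrK.
have [b [_ [_ [_ _ _ _ [_ refl]]]]] := sq.
pose D : set R := [set y | exists l k : int, y = 2 * b / beta + 1 + (l%:~R * beta^-1 + k%:~R)].
have [||x [z [Ax Az [l [k xz]]]]] := sum_meets_dense A D mA.
- by apply/eqP => A0; move: aA; rewrite A0 lee_fin leNgt apos.
- move=> c1 c2 c12.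
  have [l [k /andP[h1 h2]]] := irrational_dense beta^-1 (c1 - (2 * b / beta + 1))
     (c2 - (2 * b / beta + 1)) irrV ltac:(lra).
  exists (2 * b / beta + 1 + (l%:~R * beta^-1 + k%:~R)); first by exists l, k.
  by apply/andP; split; lra.
have [_ ex gx _] := AP x Ax; have [_ ez gz _] := AP z Az.
pose z' := z + (- k)%:~R.
have z'E : z' = 2 * b / beta + 1 + l%:~R / beta - x.
  have -> : z' = (x + z) - x - k%:~R by rewrite /z' mulrNz; ring.
  by rewrite xz; ring.
have gz' : good_orbit p q u z' by exact: good_orbit_shift.
have ux0 : 0 < u x by exact: lt_le_trans ex.
have uz'0 : 0 < u z'.
  rewrite lt_neqAle u0 andbT eq_sym; apply/eqP => /(good_orbit_eq0 _ _ _ _ _ gz) uz.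
  by move: ez; rewrite uz leNgt e0.
have [M1 H1] := small x gx (u x / 2) ltac:(by rewrite divr_gt0).
have [M2 H2] := small z' gz' (u z' / 2) ltac:(by rewrite divr_gt0).
pose M := ((M1 + M2) * d)%N.
have MM : (M1 + M2 <= M)%N by rewrite leq_pmulr.
have [h1 h2] := H1 M (leq_trans (leq_addr _ _) MM).
have [h3 h4] := H2 M (leq_trans (leq_addl _ _) MM).
have tx := two_sided_identity p q u x M gx (pper _).
have tz := two_sided_identity p q u z' M gz' (pper _).
have per (m : int) y : q (y + m%:~R / beta) = q y by exact: sine_like_period.
have r1 : orbit_prod q M z' = orbit_prod q M (x - M%:R).
  by rewrite z'E; exact: orbit_prod_reflect.
have r2 : orbit_prod q M (z' - M%:R) = orbit_prod q M x.
  rewrite -(orbit_prod_reflect beta b q l M z' refl per); congr orbit_prod.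
  by rewrite z'E; ring.
rewrite r1 r2 in tz.
have P1 := orbit_prod_gt0 _ _ _ _ M _ gx sq.
have P0 := orbit_prod_sub_gt0 _ _ _ _ M _ gx sq.
set Q1 := orbit_prod q M x in tx tz P1.
set Q0 := orbit_prod q M (x - M%:R) in tx tz P0.
have hx : u (x + M%:R) * u (x - M%:R) <= u x ^+ 2 / 4.
  by have := ler_pM (u0 _) (u0 _) h1 h2; rewrite expr2; nra.
have hz : u (z' + M%:R) * u (z' - M%:R) <= u z' ^+ 2 / 4.
  by have := ler_pM (u0 _) (u0 _) h3 h4; rewrite expr2; nra.
have k1 : u x ^+ 2 * Q0 <= u x ^+ 2 / 4 * Q1.
  by rewrite -tx ler_wpM2r// ltW.
have k2 : u z' ^+ 2 * Q1 <= u z' ^+ 2 / 4 * Q0.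
  by rewrite -tz ler_wpM2r// ltW.
have {}k1 : Q0 <= Q1 / 4.
  by rewrite -(ler_pM2l (exprn_gt0 2 ux0)) (le_trans k1)// mulrA mulrAC.
have {}k2 : Q1 <= Q0 / 4.
  by rewrite -(ler_pM2l (exprn_gt0 2 uz'0)) (le_trans k2)// mulrA mulrAC.
lra.
Qed.

End core_b.

(** * Moduli of trigonometric binomials *)

Section symbols.
Context {R : realType}.
Local Notation mu := (@lebesgue_measure R).

Lemma abs_sin_le (h : R) : `|sin h| <= `|h|.
Proof.
wlog h0 : h / 0 < h => [H|].
  have [->|hn0] := eqVneq h 0; first by rewrite sin0.
  have [hp|hn] := ltP 0 h; first exact: H.
  rewrite -normrN -sinN -[leRHS]normrN; apply: H.
  by rewrite oppr_gt0 lt_neqAle hn0.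
have [c _] : exists2 c, c \in `]0, h[ & sin h - sin 0 = cos c * (h - 0).
  apply: MVT => //.
  by apply: continuous_subspaceT => x; exact: continuous_sin.
rewrite sin0 !subr0 => ->; rewrite normrM ler_piMl//; exact: cos_max.
Qed.

Lemma abs_sinD_le (y h : R) : `|sin (y + h)| <= `|sin y| + `|h|.
Proof.
rewrite sinD; apply: (le_trans (ler_normD _ _)); rewrite !normrM; apply: lerD.
  by rewrite ler_piMr// cos_max.
by apply: le_trans (abs_sin_le h); rewrite ler_piMl// cos_max.
Qed.

Lemma polar (z : R[i]) : exists rho b : R, [/\ 0 <= rho,
  complex.Re z = rho * cos (2 * pi * b) & complex.Im z = rho * sin (2 * pi * b)].
Proof.
have pi0 := pi_gt0 R; have pin0 : pi != 0 :> R by rewrite gt_eqF.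
case: z => x y /=; set rho := Num.sqrt (x ^+ 2 + y ^+ 2).
have s0 : 0 <= x ^+ 2 + y ^+ 2 by rewrite addr_ge0// sqr_ge0.
have rE : rho ^+ 2 = x ^+ 2 + y ^+ 2 by rewrite sqr_sqrtr.
have r0 : 0 <= rho by exact: sqrtr_ge0.
have [re0|rn0] := eqVneq rho 0.
  exists 0, 0; move: rE; rewrite re0 expr0n/= => /esym/eqP.
  rewrite paddr_eq0 ?sqr_ge0// !sqrf_eq0 => /andP[/eqP -> /eqP ->].
  by rewrite !mul0r.
have rp : 0 < rho by rewrite lt_def rn0.
have xr : -1 <= x / rho <= 1.
  rewrite -ler_norml normrM normfV [`|rho|]ger0_norm// ler_pdivrMr// mul1r.
  rewrite -(@ler_pXn2r _ 2)// ?nnegrE// real_normK ?num_real// rE.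
  by rewrite lerDl sqr_ge0.
have cE : cos (acos (x / rho)) = x / rho by rewrite acosK// in_itv.
have sE : sin (acos (x / rho)) = `|y| / rho.
  rewrite sin_acos// -[RHS]ger0_norm ?divr_ge0// -sqrtr_sqr; congr Num.sqrt.
  rewrite !expr_div_n real_normK ?num_real// rE; field.
  by rewrite -rE expf_neq0.
pose t := acos (x / rho) / (2 * pi).
have tE : 2 * pi * t = acos (x / rho) by rewrite /t mulrC divfK// mulf_neq0.
have [y0|y0] := leP 0 y.
  exists rho, t; split; rewrite // tE ?cE ?sE ?(ger0_norm y0); field; exact: rn0.
exists rho, (- t); split; rewrite // mulrN tE ?cosN ?sinN ?cE ?sE ?(ltr0_norm y0); field; exact: rn0.
Qed.

Lemma normc_ge0 (z : R[i]) : 0 <= normc z.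
Proof. by case: z => x y; exact: sqrtr_ge0. Qed.

Lemma normc_eq0 (z : R[i]) : (normc z == 0) = (z == 0).
Proof.
by apply/eqP/eqP => [/eq0_normc//|->]; rewrite normc0.
Qed.

Lemma normcN (z : R[i]) : normc (- z) = normc z.
Proof. by case: z => x y /=; rewrite !sqrrN. Qed.

(** The modulus depends on t only through |sin (pi (t - b))|, which is what makes
    the period, the symmetry and the lower bound of sine_like evident. *)
Lemma normc_cisB (t rho b : R) :
  normc (cis2pi t - Complex (rho * cos (2 * pi * b)) (rho * sin (2 * pi * b))) =
  Num.sqrt ((1 - rho) ^+ 2 + 4 * rho * `|sin (pi * (t - b))| ^+ 2).
Proof.
rewrite /normc/=; congr Num.sqrt; rewrite real_normK ?num_real//.
set A := 2 * pi * t; set B := 2 * pi * b.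
have AB : A - B = (pi * (t - b)) *+ 2 by rewrite mulr2n /A /B; ring.
have : cos (A - B) = 1 - 2 * sin (pi * (t - b)) ^+ 2.
  rewrite AB cos_mulr2n; have := cos2Dsin2 (pi * (t - b)); rewrite mulr2n.
  by move=> h; lra.
rewrite cosB => E; have hA := cos2Dsin2 A; have hB := cos2Dsin2 B.
rewrite (_ : _ + _ = (cos A ^+ 2 + sin A ^+ 2) + rho ^+ 2 * (cos B ^+ 2 + sin B ^+ 2)
   - 2 * rho * (cos A * cos B + sin A * sin B)); last by ring.
by rewrite hA hB E; ring.
Qed.

Lemma sqrt_sqrD_le (a t h : R) : 0 <= t -> 0 <= h ->
  Num.sqrt (a ^+ 2 + (t + h) ^+ 2) <= Num.sqrt (a ^+ 2 + t ^+ 2) + h.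
Proof.
move=> t0 h0; have s0 := sqrtr_ge0 (a ^+ 2 + t ^+ 2).
have sE := sqr_sqrtr (addr_ge0 (sqr_ge0 a) (sqr_ge0 t)).
have ts : t <= Num.sqrt (a ^+ 2 + t ^+ 2).
  by rewrite -[leLHS](ger0_norm t0) -sqrtr_sqr ler_wsqrtr// lerDr sqr_ge0.
rewrite -[leRHS]ger0_norm ?addr_ge0// -sqrtr_sqr ler_wsqrtr//.
set S := Num.sqrt _ in s0 sE ts *.
have : t * h <= S * h by rewrite ler_wpM2r.
nra.
Qed.

Lemma sine_like_const (w k : R) (p : R -> R) : 0 < k -> (forall x, p x = k) -> sine_like w p.
Proof.
move=> k0 pk; exists 0, k, 0; split => //.
- by move=> x; rewrite pk ler_piMr ?sin_max// ltW.
- by move=> x h; rewrite !pk mul0r addr0.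
- by split => x; rewrite !pk.
Qed.

(** Factor out d' and write - d / d' = rho e(b) in polar form; normc_cisB then
    describes the remaining factor e(w x) - rho e(b). *)
Lemma sine_like_symbol (w : R) (d d' : R[i]) : w != 0 -> (d != 0) || (d' != 0) ->
  sine_like w (fun x => normc (d + d' * cis2pi (w * x))).
Proof.
move=> w0; have [->/= dn0|d'0 _] := eqVneq d' 0.
  rewrite orbF in dn0; apply: (sine_like_const _ (normc d)).
    by rewrite lt_def normc_eq0 dn0 normc_ge0.
  by move=> x; rewrite mul0r addr0.
have nd' : 0 < normc d' by rewrite lt_def normc_eq0 d'0 normc_ge0.
have [rho [b [r0 rE1 rE2]]] := polar (- (d / d')).
have pE x : normc (d + d' * cis2pi (w * x)) = normc d' *
   Num.sqrt ((1 - rho) ^+ 2 + (2 * Num.sqrt rho * `|sin (pi * (w * x - b))|) ^+ 2).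
  have -> : (2 * Num.sqrt rho * `|sin (pi * (w * x - b))|) ^+ 2 =
      4 * rho * `|sin (pi * (w * x - b))| ^+ 2.
    by rewrite -[in RHS](sqr_sqrtr r0); ring.
  rewrite -normc_cisB -normcM; congr normc.
  have -> : Complex (rho * cos (2 * pi * b)) (rho * sin (2 * pi * b)) = - (d / d').
    by rewrite -rE1 -rE2; case: (- _).
  by rewrite mulrBr mulrN opprK addrC [d' * (d / d')]mulrCA divff// mulr1.
have sr0 := sqrtr_ge0 rho.
exists b, (normc d'), (normc d' * (2 * Num.sqrt rho * (pi * `|w|))).
have pi0 := pi_gt0 R.
split => //.
- by apply: mulr_ge0; [exact: ltW|rewrite !mulr_ge0// ltW].
- move=> x; rewrite pE ler_pM2l//.
  set s := `|sin _|.
  have s0 : 0 <= s by exact: normr_ge0.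
  have s1 : s <= 1 by exact: sin_max.
  rewrite -[leLHS]ger0_norm// -sqrtr_sqr ler_wsqrtr//.
  have -> : (2 * Num.sqrt rho * s) ^+ 2 = 4 * rho * s ^+ 2.
    by rewrite -[in RHS](sqr_sqrtr r0); ring.
  have s21 : 0 <= s ^+ 2 <= 1 by rewrite sqr_ge0 expr_le1.
  case/andP: s21 => h0 h1.
  (* convex combination of the values at s = 0 and s = 1 *)
  have e1 : 0 <= (1 - s ^+ 2) * (1 - rho) ^+ 2 by rewrite mulr_ge0 ?sqr_ge0// subr_ge0.
  have e2 : 0 <= s ^+ 2 * rho ^+ 2 by rewrite mulr_ge0 ?sqr_ge0.
  have e3 := mulr_ge0 h0 r0; nra.
- move=> x h; rewrite !pE -(mulrA (normc d')) -mulrDr ler_pM2l//.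
  have w2 : 0 <= 2 * Num.sqrt rho by rewrite mulr_ge0.
  have t0 : 0 <= 2 * Num.sqrt rho * `|sin (pi * (w * x - b))| by rewrite mulr_ge0.
  have h0 : 0 <= 2 * Num.sqrt rho * (pi * `|w|) * `|h|.
    by rewrite !mulr_ge0// ltW.
  apply: le_trans (sqrt_sqrD_le _ _ _ t0 h0); rewrite ler_wsqrtr// lerD2l.
  apply: lerXn2r; rewrite ?nnegrE ?mulr_ge0//; first by rewrite addr_ge0.
  rewrite -(mulrA (2 * _)) -mulrDr ler_wpM2l//.
  rewrite (_ : pi * (w * (x + h) - b) = pi * (w * x - b) + pi * w * h); last by ring.
  apply: (le_trans (abs_sinD_le _ _)).
  by rewrite !normrM (gtr0_norm pi0).
- split => x; rewrite !pE.
    rewrite (_ : pi * (w * (x + w^-1) - b) = pi * (w * x - b + 1%:~R)).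
      by rewrite abs_sin_pi_int.
    by congr (pi * _); rewrite [w * _]mulrDr mulfV//; ring.
  rewrite (_ : pi * (w * (2 * b / w - x) - b) = - (pi * (w * x - b))).
    by rewrite sinN normrN.
  by field.
Qed.

Lemma sine_like_flip (w : R) (p : R -> R) : w != 0 -> sine_like w p ->
  sine_like w (fun x => p (- 1 - x)).
Proof.
move=> w0 [b [c [L [c0 L0 cp Lp [per refl]]]]].
exists (- w - b), c, L; split => //.
- move=> x; rewrite (_ : pi * _ = - (pi * (w * (- 1 - x) - b))); last by ring.
  by rewrite sinN normrN.
- by move=> x h; rewrite opprD addrA -[`|h|]normrN.
- split => x.
    by rewrite -[LHS]per; congr p; ring.
  by rewrite -[RHS]refl; congr p; field.
Qed.

(** Reading the relation from right to left exchanges its two coefficients. *)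
Lemma good_orbit_flip (p q u : R -> R) x : good_orbit p q u (- x) ->
  good_orbit (fun x => q (- 1 - x)) (fun x => p (- 1 - x)) (fun x => u (- x)) x.
Proof.
move=> [H1 H2 H3].
have E (n : int) : - 1 - (x + n%:~R) = - x + (- 1 - n)%:~R.
  by rewrite intrD mulrNz; ring.
split => [n|n|e e0].
- rewrite !E; have := H1 (- 1 - n).
  rewrite (_ : - x + (- 1 - n)%:~R + 1 = - (x + n%:~R)); last by rewrite -E; ring.
  by move=> ->; congr (_ * u _); rewrite -E; ring.
- by rewrite !E; have [] := H2 (- 1 - n).
- have [M HM] := H3 e e0; exists M => n Mn.
  by have := HM (- n); rewrite abszN mulrNz opprD; apply.
Qed.

(** Infinitely many good approximations of one of the two ratios suffice: either
    beta / alpha has infinitely many, or, from some point on, all belong to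
    alpha / beta, and the reflected relation applies. *)
Theorem no_decaying_orbit (alpha beta : R) (p q u : R -> R) :
  alpha != 0 -> beta != 0 -> sine_like alpha p -> sine_like beta q ->
  measurable_fun [set: R] u -> (forall x, 0 <= u x) ->
  {ae mu, forall x, good_orbit p q u x} ->
  (exists D, 0 <= D /\ forall n0 : nat, exists (n : nat) (m : int), (n0 <= n)%N /\
     (n%:R * ln n%:R * `|n%:R * (beta / alpha) - m%:~R| <= D \/
      n%:R * ln n%:R * `|n%:R * (alpha / beta) - m%:~R| <= D))
  \/ (rational alpha \/ rational beta) ->
  {ae mu, forall x, u x = 0}.
Proof.
move=> a0 b0 sp sq mu_u u0 good H.
pose v x := u (- x).
have mv : measurable_fun [set: R] v.
  have -> : v = u \o (fun x => 0 - x) by apply/funext => x; rewrite /v/= sub0r.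
  exact: (measurableT_comp mu_u (measurable_flip 0)).
have back : {ae mu, forall x, v x = 0} -> {ae mu, forall x, u x = 0}.
  move=> /(ae_flip 0); apply: ae_impl => x; by rewrite /v sub0r opprK.
have goodv : {ae mu, forall x, good_orbit (fun x => q (- 1 - x)) (fun x => p (- 1 - x)) v x}.
  have := ae_flip 0 _ good; apply: ae_impl => x; rewrite sub0r; exact: good_orbit_flip.
have sp' := sine_like_flip _ _ a0 sp; have sq' := sine_like_flip _ _ b0 sq.
case: H => [[D [D0 H]]|[ra|rb]].
- have [Hfreq|Hfreq] := pselect (forall n0 : nat, exists (n : nat) (m : int), (n0 <= n)%N /\
     n%:R * ln n%:R * `|n%:R * (beta / alpha) - m%:~R| <= D).
    by apply: (no_decaying_orbit_diophantine alpha beta p q) => //; exists D.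
  apply: back; apply: (no_decaying_orbit_diophantine beta alpha _ _ v b0 a0 sq' sp') => //.
    by move=> x; exact: u0.
  exists D; split => // n0; move/existsNP: Hfreq => [n1 /forallNP Hn1].
  have [n [m [nn [h|h]]]] := H (n0 + n1)%N.
    exfalso; apply: (Hn1 n); exists m; split => //.
    by apply: leq_trans nn; exact: leq_addl.
  by exists n, m; split => //; apply: leq_trans nn; exact: leq_addr.
- exact: (no_decaying_orbit_rational alpha beta p q).
- apply: back; apply: (no_decaying_orbit_rational beta alpha _ _ v b0 a0 sq' sp') => //.
  by move=> x; exact: u0.
Qed.

End symbols.

(** * From Lebesgue measurable functions to Borel functions *)

Section lebesgue_borel.
Context {R : realType}.
Local Notation mu := (@lebesgue_measure R).
Local Notation cmu := (@completed_lebesgue_measure R).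

(** Both measures are restrictions of one outer measure, whose null sets are the
    subsets of Borel null sets. *)
Lemma ae_completedP (P : R -> Prop) :
  {ae cmu, forall x, P x} <-> {ae mu, forall x, P x}.
Proof.
split.
  move=> [B [mB B0 PB]]; apply/negligible_outer_measure.
  apply/eqP; rewrite eq_le outer_measure_ge0 andbT -[X in (_ <= X)%E]B0.
  exact: le_outer_measure.
move=> [B [mB B0 PB]]; exists B; split => //.
exact: sub_caratheodory.
Qed.

Lemma lebesgue_borelU (A : set (lebesgueType R)) : measurable A ->
  exists X N : set R, [/\ measurable X, mu.-negligible N & A = X `|` N].
Proof.
move=> mA; have : (measurable_realfun.completed_algebra_gen mu) A.
  rewrite -g_sigma_completed_algebra_genE completed_caratheodory_measurable; exact: mA.
by move=> [X mX [N negN XN]]; exists X, N.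
Qed.

Lemma lebesgue_borel_cover (A : set (lebesgueType R)) : measurable A ->
  (cmu A < +oo)%E -> exists B : set R, [/\ measurable B, A `<=` B & (mu B < +oo)%E].
Proof.
move=> mA fA; have [X [N [mX [N' [mN' N'0 NN']] AE]]] := lebesgue_borelU A mA.
exists (X `|` N'); split.
- exact: measurableU.
- by rewrite AE; exact: setUS.
- rewrite (measureU0 (mu := mu) mX mN' N'0); apply: le_lt_trans fA.
  by apply: le_outer_measure; rewrite AE; exact: subsetUl.
Qed.

(** Modify g on one Borel null set that contains the null parts of all the sets
    g > r with r rational; these countably many sets become Borel and determine the
    measurability of the modified function. *)
Lemma borel_version (g : R -> R) : measurable_fun [set: lebesgueType R] g ->
  (forall x, 0 <= g x) ->
  exists u : R -> R, [/\ measurable_fun [set: R] u, forall x, 0 <= u x &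
     {ae mu, forall x, u x = g x}].
Proof.
move=> mg g0.
have mrat (r : rat) : measurable (g @^-1` `]ratr r, +oo[%classic : set (lebesgueType R)).
  by rewrite -[X in measurable X]setTI; exact: mg.
have /choice[XN HXN] (r : rat) : exists XN : set R * set R, [/\ measurable XN.1,
   mu.-negligible XN.2 & g @^-1` `]ratr r, +oo[%classic = XN.1 `|` XN.2].
  by have [X [N H]] := lebesgue_borelU _ (mrat r); exists (X, N).
have [N [mN N0 HN]] : mu.-negligible (\bigcup_k
    (if (unpickle k : option rat) is Some r then (XN r).2 else set0)).
  apply: negligible_bigcup => k; case: unpickle => [r|]; last exact: negligible_set0.
  by have [] := HXN r.
pose u x := if x \in N then 0 else g x.
exists u; split.
- have mu_rat (r : rat) : measurable (u @^-1` `]ratr r, +oo[%classic).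
    have [mX _ XE] := HXN r.
    have E : u @^-1` `]ratr r, +oo[%classic =
        ((XN r).1 `\` N) `|` (if (ratr r < 0 :> R) then N else set0).
      apply/seteqP; split => x; rewrite /u/= in_itv/= andbT.
        case: ifP => [/set_mem Nx r0|/negbT/negP nNx rg].
          by right; rewrite r0.
        left; split; last by move=> Nx; apply: nNx; exact/mem_set.
        have : (g @^-1` `]ratr r, +oo[%classic) x by rewrite /= in_itv/= andbT.
        rewrite XE => -[//|XN2]; exfalso; apply: nNx; apply/mem_set/HN.
        exists (pickle r); [exact: I|rewrite pickleK; exact: XN2].
      case => [[Xx nNx]|].
        rewrite memNset//.
        have : (g @^-1` `]ratr r, +oo[%classic) x by rewrite XE; left.
        by rewrite /= in_itv/= andbT.
      by case: ifP => // r0 Nx; rewrite mem_set.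
    rewrite E; apply: measurableU; first exact: measurableD.
    by case: ifP.
  apply: (measurability _ (RGenOInfty.measurableE R)).
  move=> _ [_ [a ->] <-]; rewrite setTI.
  rewrite (_ : _ @^-1` _ = \bigcup_k (if (unpickle k : option rat) is Some r then
      if (a <= ratr r) then u @^-1` `]ratr r, +oo[%classic else set0 else set0)).
    by apply: bigcupT_measurable => k; case: unpickle => // r; case: ifP => // _; exact: mu_rat.
  apply/seteqP; split => x /=; rewrite in_itv/= andbT.
    move=> /rat_in_itvoo[r]; rewrite in_itv/= => /andP[r1 r2].
    exists (pickle r); [exact: I|rewrite pickleK (ltW r1) /= in_itv/= andbT; exact: r2].
  move=> [k _]; case: unpickle => // r; case: ifP => //= ar; rewrite in_itv/= andbT.
  exact: le_lt_trans.
- by move=> x; rewrite /u; case: ifP.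
- exists N; split => // x /= ux; apply: contrapT => nNx; apply: ux.
  by rewrite /u memNset.
Qed.


Lemma measurable_normc (f : R -> R[i]) : cmeasurable f ->
  measurable_fun [set: lebesgueType R] (fun x => normc (f x)).
Proof.
move=> [mRe mIm].
have -> : (fun x => normc (f x)) = Num.sqrt \o
    ((fun x => complex.Re (f x) ^+ 2) \+ (fun x => complex.Im (f x) ^+ 2)).
  by apply/funext => x /=; case: (f x).
apply: measurableT_comp.
  by apply: continuous_measurable_fun; exact: sqrt_continuous.
by apply: measurable_funD; exact: measurable_funX.
Qed.

(** The unit intervals cut B into pieces; moved back to [0, 1[, their measures
    have the finite sum mu B, so almost every point lies in finitely many of them. *)
Lemma finite_measure_orbits (B : set R) : measurable B -> (mu B < +oo)%E ->
  {ae mu, forall x, finite_set [set n : int | B (x + n%:~R)]}.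
Proof.
move=> mB fB.
pose G (k : nat) : set R := if (pickle_inv k : option int) is Some n
  then B `&` `[n%:~R, (n + 1)%:~R[%classic else set0.
pose F (k : nat) : set R := if (pickle_inv k : option int) is Some n
  then (fun x => x + n%:~R) @^-1` G k else set0.
have mG k : measurable (G k).
  by rewrite /G; case: pickle_inv => // n; exact: measurableI.
have mF k : measurable (F k).
  rewrite /F; case: pickle_inv => // n.
  by rewrite -[X in measurable X]setTI; exact: (measurable_shift n%:~R).
have muFG k : mu (F k) = mu (G k).
  rewrite /F; case E : (pickle_inv k : option int) => [n|].
    exact: lebesgue_measure_shift.
  by rewrite /G E.
have tG : trivIset setT G.
  apply/trivIsetP => i j _ _ ij; rewrite /G.
  case Ei : (pickle_inv i : option int) => [n|]; last by rewrite set0I.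
  case Ej : (pickle_inv j : option int) => [m|]; last by rewrite setI0.
  apply/eqP/negPn/negP => /set0P[x [[_ xn] [_ xm]]].
  move: xn xm; rewrite /= !in_itv/= => /andP[n1 n2] /andP[m1 m2].
  have nm : n = m.
    have := le_lt_trans n1 m2; have := le_lt_trans m1 n2; rewrite !ltr_int.
    clear; lia.
  have := pickle_invK (T := int) i; have := pickle_invK (T := int) j.
  by rewrite Ei Ej nm /= => jE iE; move/eqP: ij; rewrite -jE -iE.
have mL : measurable (lim_sup_set F).
  by apply: bigcapT_measurable => n; apply: bigcup_measurable => k _; exact: mF.
have L0 : mu (lim_sup_set F) = 0%E.
  apply: (lim_sup_set_cvg0 (mu := mu)) => //.
  have mcup : measurable (\bigcup_k G k) by exact: bigcupT_measurable.
  have : (mu (\bigcup_k G k) < +oo)%E.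
    apply: le_lt_trans fB; apply: le_measure; rewrite ?inE//.
    by move=> x [k _]; rewrite /G; case: pickle_inv => // n [].
  have := @measure_semi_sigma_additive _ _ _ mu G mG tG mcup.
  move=> /cvg_lim <-//.
  rewrite (_ : (fun _ => _) = (fun n => (\sum_(0 <= i < n) mu (F i))%E))//.
  by apply/funext => n; apply: eq_bigr => i _; rewrite muFG.
have ae1 : {ae mu, forall x, ~ lim_sup_set F x}.
  exists (lim_sup_set F); split => //.
  by move=> x /= /contrapT.
apply: ae_impl (ae_shift_int _ ae1) => x Hx.
pose m := - Num.floor x.
have /existsNP[N /not_implyP[_ HN]] := Hx m.
apply: (@sub_finite_set _ _ ((fun k => odflt 0 (pickle_inv k : option int) + m) @` `I_N)).
  move=> n /= Bn; exists (pickle (n - m)); last by rewrite pickleK_inv/= subrK.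
  rewrite /mkset ltnNge; apply/negP => Nk; apply: HN; exists (pickle (n - m)); first exact: Nk.
  rewrite /F /G pickleK_inv /=.
  have -> : x + m%:~R + (n - m)%:~R = x + n%:~R by rewrite intrD mulrNz; ring.
  split => //=; rewrite in_itv/= /m !intrD !mulrNz.
  have := floor_le x; have := floorD1_gt x; rewrite intrD => h1 h2.
  by apply/andP; split; rewrite ?opprK; lra.
exact: finite_image (finite_II _).
Qed.

Lemma frechet_filter_int : Filter (@frechet_filter int : set_system int).
Proof.
split; rewrite /frechet_filter.
- by rewrite /= setCT; exact: finite_set0.
- by move=> P Q /= fP fQ; rewrite setCI finite_setU.
- by move=> P Q PQ /=; apply: sub_finite_set; exact: subsetC.
Qed.

(** By Chebyshev's inequality each set |f| >= 1 / (k + 1) has finite measure, so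
    that almost every orbit visits it finitely often. *)
Lemma square_integrable_decay (f : R -> R[i]) : square_integrable f -> minimal_decay f.
Proof.
move=> [mf fint]; have mnf := measurable_normc _ mf.
apply/ae_completedP.
pose D (k : nat) : set (lebesgueType R) := [set x | (k.+1%:R^-1 <= normc (f x))%R].
have aeD k : {ae mu, forall x, finite_set [set n : int | D k (x + n%:~R)]}.
  have mD : measurable (D k).
    rewrite (_ : D k = (fun x => normc (f x)) @^-1` `[k.+1%:R^-1, +oo[%classic).
      by rewrite -[X in measurable X]setTI; exact: mnf.
    by apply/seteqP; split => x; rewrite /D/= in_itv/= andbT.
  have fD : (cmu (D k) < +oo)%E.
    have k0 : 0 < k.+1%:R^-1 ^+ 2 :> R by rewrite exprn_gt0// invr_gt0.
    have := @le_integral_comp_abse _ _ _ cmu _ measurableT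
       (fun x => (normc (f x) ^+ 2)%:E) (k.+1%:R^-1 ^+ 2) id.
    move=> /(_ (@measurable_id _ _ _) (fun r h => h) (fun _ _ _ _ h => h)).
    have mn2 : measurable_fun [set: lebesgueType R] (fun x => (normc (f x) ^+ 2)%:E).
      by apply/measurable_EFinP; apply: measurable_funX; exact: mnf.
    move=> /(_ mn2 k0).
    under eq_integral => x _ do rewrite /= ger0_norm ?exprn_ge0 ?normc_ge0//.
    move=> /le_lt_trans/(_ fint); rewrite setTI.
    rewrite (_ : [set x | _] = D k); last first.
      apply/seteqP; split => x; rewrite /D/= lee_fin ger0_norm ?exprn_ge0 ?normc_ge0//.
        by rewrite ler_pXn2r// nnegrE ?normc_ge0// invr_ge0.
      by rewrite ler_pXn2r// nnegrE ?normc_ge0// invr_ge0.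
    move=> H; rewrite ltey; apply/eqP => Dk; move: H.
    rewrite [X in (_ * X)%E](_ : _ = +oo%E)// gt0_muley ?lte_fin//.
  have [B [mB DB fB]] := lebesgue_borel_cover _ mD fD.
  apply: ae_impl (finite_measure_orbits B mB fB) => x.
  by apply: sub_finite_set => n /= /DB.
apply: ae_impl (ae_foralln aeD) => x Hx.
have FF := frechet_filter_int; apply/cvgrPdist_lt => e e0.
have := Hx (Num.truncn e^-1); apply: sub_finite_set => n /= He.
rewrite /D /=; apply: contrapT => /negP; rewrite -ltNge => h; apply: He.
rewrite sub0r normrN ger0_norm ?normc_ge0//; apply: (lt_trans h).
by rewrite -[ltRHS]invrK ltf_pV2 ?posrE ?invr_gt0//; exact: truncnS_gt.
Qed.

Lemma minimal_decay_bound (f : R -> R[i]) (x : R) :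
  normc (f (x + n%:~R)) @[n --> (@frechet_filter int : set_system int)] --> (0 : R) ->
  forall e, 0 < e -> exists M : nat, forall n : int, (M <= `|n|)%N ->
    normc (f (x + n%:~R)) <= e.
Proof.
have FF := frechet_filter_int; move=> /cvgrPdist_lt H e e0.
have : finite_set (~` [set n : int | `|0 - normc (f (x + n%:~R))| < e]) := H e e0.
move=> /finite_seqP[/= s sE].
exists (\max_(n <- s) `|n|%N).+1 => n Mn; apply: contrapT => /negP; rewrite -ltNge => h.
have : n \in s.
  suff : [set` s] n by [].
  rewrite -sE /=; rewrite sub0r normrN ger0_norm ?normc_ge0// => he.
  by have := lt_trans h he; rewrite ltxx.
move=> ns; have := leq_bigmax_seq (F := fun n : int => `|n|%N) n ns isT.
by rewrite leqNgt Mn.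
Qed.

(** If one of the two symbols vanishes identically, then the other one is nonzero
    a.e. and the relation forces f = 0.  Otherwise both moduli are sine_like, and
    no_decaying_orbit applies to a Borel version of |f|. *)
Theorem no_decaying_dependence (alpha beta : R) (f : R -> R[i]) :
  alpha != 0 -> beta != 0 ->
  (exists D, 0 <= D /\ forall n0 : nat, exists (n : nat) (m : int), (n0 <= n)%N /\
     (n%:R * ln n%:R * `|n%:R * (beta / alpha) - m%:~R| <= D \/
      n%:R * ln n%:R * `|n%:R * (alpha / beta) - m%:~R| <= D))
  \/ (rational alpha \/ rational beta) ->
  cmeasurable f -> minimal_decay f ->
  tf_dependent [tuple (0, 0); (1, 0); (0, alpha); (1, beta)] f -> ae_zero f.
Proof.
move=> a0 b0 hab mf /ae_completedP decf [d [[j0 dj0] /ae_completedP depf]].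
apply/ae_completedP.
pose i0 : 'I_4 := ord0; pose i1 : 'I_4 := lift ord0 ord0.
pose i2 : 'I_4 := lift ord0 (lift ord0 ord0).
pose i3 : 'I_4 := lift ord0 (lift ord0 (lift ord0 ord0)).
pose p x := normc (d i0 + d i2 * cis2pi (alpha * x)).
pose q x := normc (d i1 + d i3 * cis2pi (beta * x)).
have zf : {ae mu, forall x, normc (f x) = 0} -> {ae mu, forall x, f x = 0}.
  by apply: ae_impl => x /eqP; rewrite normc_eq0 => /eqP.
have rel : {ae mu, forall x, q x * normc (f (x + 1)) = p x * normc (f x)}.
  move: depf; apply: ae_impl => x.
  rewrite !big_ord_recl big_ord0 /= -/i0 -/i1 -/i2 -/i3 => E.
  have c0 : cis2pi (0 * x) = 1 by rewrite /cis2pi mul0r mulr0 cos0 sin0.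
  rewrite c0 !addr0 !mulr1 in E.
  rewrite /q /p -!normcM -[RHS]normcN; congr normc.
  by apply/eqP; rewrite -subr_eq0 opprK -[X in _ == X]E; apply/eqP; ring.
have p_symbol : (d i0 != 0) || (d i2 != 0) -> sine_like alpha p by exact: sine_like_symbol.
have q_symbol : (d i1 != 0) || (d i3 != 0) -> sine_like beta q by exact: sine_like_symbol.
have [/p_symbol sp|] := boolP ((d i0 != 0) || (d i2 != 0)); last first.
  rewrite negb_or !negbK => /andP[/eqP d0 /eqP d2].
  have /q_symbol sq : (d i1 != 0) || (d i3 != 0).
    apply: contraNT dj0; rewrite negb_or !negbK => /andP[/eqP d1 /eqP d3].
    case: j0 => -[|[|[|[|m]]]] jm //; apply/eqP.
    - by rewrite -[RHS]d0; congr d; exact/val_inj.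
    - by rewrite -[RHS]d1; congr d; exact/val_inj.
    - by rewrite -[RHS]d2; congr d; exact/val_inj.
    - by rewrite -[RHS]d3; congr d; exact/val_inj.
  have f1 : {ae mu, forall x, normc (f (x + 1)) = 0}.
    apply: ae_impl (ae_and _ _ rel (sine_like_neq0 beta q b0 sq)) => x [+ qx].
    rewrite /p d0 d2 mul0r addr0 normc0 mul0r => /eqP.
    by rewrite mulf_eq0 (negbTE qx) => /eqP.
  apply: zf; have := ae_shift (- 1) _ f1.
  by apply: ae_impl => x; rewrite subrK.
have [/q_symbol sq|] := boolP ((d i1 != 0) || (d i3 != 0)); last first.
  rewrite negb_or !negbK => /andP[/eqP d1 /eqP d3].
  apply: zf; apply: ae_impl (ae_and _ _ rel (sine_like_neq0 alpha p a0 sp)) => x [+ px].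
  rewrite /q d1 d3 mul0r addr0 normc0 mul0r => /esym/eqP.
  by rewrite mulf_eq0 (negbTE px) => /eqP.
have [u [mu_u u0 uf]] := borel_version _ (measurable_normc f mf) (fun x => normc_ge0 (f x)).
have good : {ae mu, forall x, good_orbit p q u x}.
  have pq0 := ae_and _ _ (sine_like_neq0 alpha p a0 sp) (sine_like_neq0 beta q b0 sq).
  have H1 := ae_shift_int _ (ae_and _ _ (ae_and _ _ rel (ae_shift 1 _ uf)) uf).
  apply: ae_impl (ae_and _ _ (ae_and _ _ H1 (ae_shift_int _ pq0)) decf).
  move=> x [[Hx pqx] decx]; split => [n|n|e e0].
  - by have [[r ->] ->] := Hx n.
  - exact: pqx.
  - have [M HM] := minimal_decay_bound f x decx e e0.
    by exists M => n Mn; have [_ ->] := Hx n; exact: HM.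
apply: zf; have := no_decaying_orbit alpha beta p q u a0 b0 sp sq mu_u u0 good hab.
by move=> uz; apply: ae_impl (ae_and _ _ uf uz) => x [<- ->].
Qed.

Lemma dist_int_near (x e : R) : dist_int x < e -> exists m : int, `|x - m%:~R| < e.
Proof.
move=> h; have [] := @inf_adherent R [set `|x - m%:~R| | m in [set: int]] (e - dist_int x).
- by rewrite subr_gt0.
- split; first by exists `|x - 0%:~R|, 0.
  by exists 0 => _ [m _ <-].
- move=> _ [m _ <-]; rewrite -/(dist_int x) [X in _ < X]addrC subrK => xm.
  by exists m.
Qed.

(** The limit inferior is below some real c, hence so are infinitely many terms;
    the extra 1 absorbs the error in choosing an integer that almost attains the
    distance. *)
Lemma diophantine_frequently (s t : R) :
  (limn_einf (fun n : nat => (n%:R * ln n%:R *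
      Num.min (dist_int (n%:R * s)) (dist_int (n%:R * t)))%:E) < +oo)%E ->
  exists D, 0 <= D /\ forall n0 : nat, exists (n : nat) (m : int), (n0 <= n)%N /\
     (n%:R * ln n%:R * `|n%:R * s - m%:~R| <= D \/
      n%:R * ln n%:R * `|n%:R * t - m%:~R| <= D).
Proof.
set v := (fun n : nat => _); rewrite limn_einf_lim (cvg_lim _ (@cvg_einfs_sup _ v))// => vlt.
have [c vc] : exists c : R, (ereal_sup (range (einfs v)) < c%:E)%E.
  move: vlt; case: ereal_sup => [r _| //|_]; last by exists 0; exact: ltNyr.
  by exists (r + 1); rewrite lte_fin ltrDl.
exists (`|c| + 1); split; first by rewrite addr_ge0.
move=> n0.
have [n n0n vn] : exists2 n, (n0 <= n)%N & (v n < c%:E)%E.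
  apply: contrapT => H.
  have /lt_geF := le_lt_trans (ereal_sup_ubound (ex_intro2 _ _ n0 I erefl)) vc.
  suff -> : (c%:E <= einfs v n0)%E by [].
  apply: le_ereal_inf_tmp => _ [k /= n0k <-]; rewrite leNgt; apply/negP => kc.
  by apply: H; exists k.
move: vn; rewrite /v lte_fin.
set w := n%:R * ln n%:R.
have w0 : 0 <= w.
  rewrite /w; case: (n) => [|k]; first by rewrite mul0r.
  by rewrite mulr_ge0// ln_ge0// ler1n.
have w1 : 0 < w + 1 by rewrite ltr_wpDl.
have we : w * (w + 1)^-1 <= 1 by rewrite ler_pdivrMr// mul1r lerDl.
have e0 : 0 < (w + 1)^-1 by rewrite invr_gt0.
have cle := ler_norm c.
have approx (y : R) : w * dist_int y < c -> exists m : int, w * `|y - m%:~R| <= `|c| + 1.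
  move=> wy; have [|m hm] := @dist_int_near y (dist_int y + (w + 1)^-1).
    by rewrite ltrDl.
  exists m; apply: (@le_trans _ _ (w * (dist_int y + (w + 1)^-1))).
    by rewrite ler_wpM2l// ltW.
  by rewrite mulrDr; apply: lerD => //; apply: le_trans cle; exact: ltW.
have [_|_] := leP (dist_int (n%:R * s)) (dist_int (n%:R * t)) => /approx[m hm].
  by exists n, m; split => //; left.
by exists n, m; split => //; right.
Qed.

End lebesgue_borel.

(** * Four points on two parallel lines *)

Theorem theorem1p5 (R : realType) (alpha beta : R)
  (alpha_neq0 : alpha != 0) (beta_neq0 : beta != 0)
  (hab :
    (limn_einf (fun n : nat =>
       (n%:R * ln n%:R *
        Num.min (dist_int (n%:R * (beta / alpha)))
                (dist_int (n%:R * (alpha / beta))))%:E) < +oo)%E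
    \/ (rational alpha \/ rational beta)) :
  (~ exists f : R -> R[i],
      [/\ square_integrable f, ~ ae_zero f &
          tf_dependent [tuple (0, 0); (1, 0); (0, alpha); (1, beta)] f])
  /\
  (~ exists f : R -> R[i],
      [/\ cmeasurable f, ~ ae_zero f,
          tf_dependent [tuple (0, 0); (1, 0); (0, alpha); (1, beta)] f &
          minimal_decay f]).
Proof.
have approx : (exists D, 0 <= D /\ forall n0 : nat, exists (n : nat) (m : int),
      (n0 <= n)%N /\
      (n%:R * ln n%:R * `|n%:R * (beta / alpha) - m%:~R| <= D \/
       n%:R * ln n%:R * `|n%:R * (alpha / beta) - m%:~R| <= D))
    \/ (rational alpha \/ rational beta).
  by case: hab => [h|h]; [left; exact: diophantine_frequently|right].
split=> [[f [sf nz dep]]|[f [mf nz dep dec]]]; apply: nz.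
  apply: (no_decaying_dependence alpha beta f alpha_neq0 beta_neq0 approx) => //.
    by case: sf.
  exact: square_integrable_decay.
exact: (no_decaying_dependence alpha beta f alpha_neq0 beta_neq0 approx).
Qed.
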